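(* Let $G$ be a countably infinite discrete amenable group, $(X,G)$ a $G$-action on a nonempty compact metric space $(X,d)$, and $\{F_n\}_{n\in\mathbb{N}}$ a tempered F\o lner sequence of $G$ satisfying $\lim_{n\to\infty}\frac{|F_n|}{\log n}=+\infty$. Then $$\overline{\mathrm{mdim}}_{M}(X,\{F_{n}\}_{n\in\mathbb{N}},d)=\max_{x\in X}\overline{\mathrm{mdim}}_{M}(x,\{F_n\}_{n\in\mathbb{N}},d),$$ $$\overline{\mathrm{mdim}}_{M}^{P}(X,\{F_{n}\}_{n\in\mathbb{N}},d)=\max_{x\in X}\overline{\mathrm{mdim}}^{P}_{M}(x,\{F_n\}_{n\in\mathbb{N}},d),$$ $$\overline{\mathrm{mdim}}_{M}^{B}(X,\{F_{n}\}_{n\in\mathbb{N}},d)=\max_{x\in X}\overline{\mathrm{mdim}}^{B}_{M}(x,\{F_n\}_{n\in\mathbb{N}},d),$$ and $$\overline{\mathrm{mdim}}_{M}(X,\{F_{n}\}_{n\in\mathbb{N}},d)=\overline{\mathrm{mdim}}_{M}^{P}(X,\{F_{n}\}_{n\in\mathbb{N}},d)=\overline{\mathrm{mdim}}_{M}^{B}(X,\{F_{n}\}_{n\in\mathbb{N}},d).$$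
   Context: **Groups and actions.** $G$ is a countably infinite discrete group with identity $e_G$; $\mathfrak{F}_G$ is the collection of finite nonempty subsets of $G$. A F\o lner sequence is a sequence $\{F_n\}_{n\in\mathbb{N}}\subset\mathfrak{F}_G$ with $\lim_{n\to\infty}\frac{|F_n\cap gF_n|}{|F_n|}=1$ for each $g\in G$; $G$ is amenable if one exists. A sequence $\{H_n\}_{n\in\mathbb N}\subset\mathfrak{F}_G$ is tempered if there is a constant $C>0$ independent of $n$ with $\left|\bigcup_{k<n}H_k^{-1}H_n\right|\le C|H_n|$ for every $n\ge 2$. A $G$-action $(X,G)$ is a nonempty compact metric space $(X,d)$ together with the group $G$ acting by self-homeomorphisms of $X$ ($e_G$ acting as the identity). **Balls.** For $F\in\mathfrak{F}_G$, $d_F(x,y)=\max_{g\in F}d(gx,gy)$. $B^F_\varepsilon(x)$ and $O^F_\varepsilon(x)$ are the closed and open balls of center $x$ and radius $\varepsilon$ in the metric $d_F$. **Topological entropy at scale $\delta$.** For nonempty $K\subset X$, $F\in\mathfrak{F}_G$, $\delta>0$: $s_F(K,\delta,d)$ is the maximal cardinality of a set $H\subset K$ with $d_F(x,y)>\delta$ for all distinct $x,y\in H$, and $h_{\mathrm{top}}(K,\delta,\{F_n\}_{n\in\mathbb N},d)=\limsup_{n\to\infty}\frac{1}{|F_n|}\log s_{F_n}(K,\delta,d)$. **Packing entropy at scale $\delta$.** For nonempty $Z\subset X$ and $\lambda,\varepsilon,\delta>0$, $P_{\lambda,\varepsilon}(\delta,Z,\{F_n\},d)=\sup\sum_{i\in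 I}\exp(-\lambda|F_{n_i}|)$, the supremum over all finite or countable families of pairwise disjoint closed balls $\{B^{F_{n_i}}_\delta(x_i)\}_{i\in I}$ with $x_i\in Z$ and $|F_{n_i}|\ge\frac1\varepsilon$ for all $i$ (value $0$ for $Z=\emptyset$). Put $P_\lambda(\delta,Z,\{F_n\},d)=\lim_{\varepsilon\to0}P_{\lambda,\varepsilon}(\delta,Z,\{F_n\},d)$, $\widetilde P_\lambda(\delta,Z,\{F_n\},d)=\inf\{\sum_{i=1}^\infty P_\lambda(\delta,Z_i,\{F_n\},d): Z\subset\bigcup_{i=1}^\infty Z_i\}$, and $h^P_{\mathrm{top}}(Z,\delta,\{F_n\}_{n\in\mathbb N},d)=\inf\{\lambda>0:\widetilde P_\lambda(\delta,Z,\{F_n\},d)=0\}$ (with $\inf\emptyset=+\infty$). **Bowen's dimensional entropy at scale $\delta$.** For nonempty $Z\subset X$ and $\lambda,\varepsilon,\delta>0$, $F_{\lambda,\varepsilon}(\delta,Z,\{F_n\},d)=\inf\sum_{i\in I}\exp(-\lambda|F_{n_i}|)$, the infimum over all finite or countable families of open balls $\{O^{F_{n_i}}_\delta(x_i)\}_{i\in I}$ covering $Z$ (with $x_i\in X$) and $|F_{n_i}|\ge\frac1\varepsilon$ for each $i$. Put $F_\lambda(\delta,Z,\{F_n\},d)=\lim_{\varepsilon\to0}F_{\lambda,\varepsilon}(\delta,Z,\{F_n\},d)$ and $h^B_{\mathrm{top}}(Z,\delta,\{F_n\}_{n\in\mathbb N},d)=\inf\{\lambda>0:F_\lambda(\delta,Z,\{F_n\},d)=0\}$.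 **Metric mean dimensions.** For nonempty $Z\subset X$, with values in $[0,+\infty]$, $$\overline{\mathrm{mdim}}_M(Z,\{F_n\},d)=\limsup_{\delta\to0}\frac{h_{\mathrm{top}}(Z,\delta,\{F_n\},d)}{\log\frac1\delta},$$ and $\overline{\mathrm{mdim}}^P_M(Z,\{F_n\},d)$, $\overline{\mathrm{mdim}}^B_M(Z,\{F_n\},d)$ are defined in the same way with $h^P_{\mathrm{top}}$, $h^B_{\mathrm{top}}$ in place of $h_{\mathrm{top}}$. For a point $x\in X$, the local version is $\overline{\mathrm{mdim}}_M(x,\{F_n\},d)=\inf_K\overline{\mathrm{mdim}}_M(K,\{F_n\},d)$, the infimum over all closed neighborhoods $K$ of $x$; the local versions $\overline{\mathrm{mdim}}^P_M(x,\cdot)$ and $\overline{\mathrm{mdim}}^B_M(x,\cdot)$ are defined analogously. *)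

(* Defs.v *)
From HB Require Import structures.
From mathcomp Require Import all_boot all_order all_algebra finmap.
From mathcomp Require Import all_classical all_reals all_analysis.

Set Implicit Arguments.
Unset Strict Implicit.
Unset Printing Implicit Defensive.

Import Order.TTheory GRing.Theory Num.Theory.
Import numFieldNormedType.Exports.

Local Open Scope classical_set_scope.
Local Open Scope ring_scope.

Section group_sequences.
Context {G : groupType}.

(* Sequences are indexed from 0: [F n] is the (n+1)-st term, so "for all
   n >= 2, union over k < n" reads "for all n > 0, union over k < n". *)

Definition folner (R : realType) (F : nat -> {fset G}) : Prop :=
  (forall n, F n != fset0) /\
  forall g : G,
    (#|` F n `&` [fset (g * h)%g | h in F n]|%fset%:R
       / #|` F n|%:R : R) @[n --> \oo] --> (1 : R).

Definition tempered (R : realType) (F : nat -> {fset G}) : Prop :=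
  exists2 C : R, 0 < C & forall n, (0 < n)%N ->
    #|` (\bigcup_(k <- iota 0 n) [fset (g^-1 * h)%g | g in F k, h in F n])%fset|%:R
      <= C * #|` F n|%:R.

End group_sequences.

Definition amenable (R : realType) (G : groupType) : Prop :=
  exists F : nat -> {fset G}, folner R F.

(* Each [act g] has the continuous inverse [act g^-1], hence is a
   homeomorphism. *)
Definition continuous_action (G : groupType) (X : topologicalType)
    (act : G -> X -> X) : Prop :=
  [/\ forall x, act 1%g x = x,
      forall g h x, act (g * h)%g x = act g (act h x) &
      forall g, continuous (act g)].

Section mean_dimension.
Context {R : realType} {G : groupType} {X : metricType R}.
Variables (act : G -> X -> X) (F : nat -> {fset G}).

Implicit Types (E : {fset G}) (x : X) (Z K : set X) (lam eps delta : R).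

(* The default value 0 is harmless: distances are nonnegative. *)
Definition dist_on E x y : R :=
  \big[Num.max/0]_(g <- E) mdist (act g x) (act g y).

Definition closed_ball_on E delta x : set X :=
  [set y | dist_on E x y <= delta].

Definition open_ball_on E delta x : set X :=
  [set y | dist_on E x y < delta].

Definition delta_separated E delta (H : {fset X}) : Prop :=
  forall x y, x \in H -> y \in H -> x != y -> delta < dist_on E x y.

Definition sep_number E K delta : \bar R :=
  ereal_sup [set (#|` H|%:R)%:E | H in
    [set H : {fset X} | [set` H] `<=` K /\ delta_separated E delta H]].

Definition htop K delta : \bar R :=
  limn_esup (fun n => ((#|` F n|%:R)^-1)%:E * lne (sep_number (F n) K delta))%E.

(* A finite or countable family of balls is a set I of naturals together with
   centers [c i] and indices [m i], which only matter for i in I. *)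

Definition family_sum lam (I : set nat) (m : nat -> nat) : \bar R :=
  (\esum_(i in I) (expR (- lam * #|` F (m i)|%:R))%:E)%E.

Definition packing delta eps Z (I : set nat) (c : nat -> X) (m : nat -> nat) :
    Prop :=
  [/\ forall i, I i -> Z (c i),
      forall i, I i -> eps^-1 <= #|` F (m i)|%:R &
      trivIset I (fun i => closed_ball_on (F (m i)) delta (c i))].

Definition packing_pre lam eps delta Z : \bar R :=
  ereal_sup [set s | exists I c m,
    packing delta eps Z I c m /\ s = family_sum lam I m].

Definition packing_lim lam delta Z : \bar R :=
  lim (packing_pre lam eps delta Z @[eps --> 0^'+]).

Definition packing_measure lam delta Z : \bar R :=
  ereal_inf [set (\sum_(0 <= i <oo) packing_lim lam delta (Zs i))%E | Zs in
    [set Zs : nat -> set X | Z `<=` \bigcup_i Zs i]].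

Definition htop_packing Z delta : \bar R :=
  ereal_inf [set lam%:E | lam in
    [set lam | 0 < lam /\ packing_measure lam delta Z = 0%E]].

Definition covering delta eps Z (I : set nat) (c : nat -> X) (m : nat -> nat) :
    Prop :=
  (forall i, I i -> eps^-1 <= #|` F (m i)|%:R) /\
  Z `<=` \bigcup_(i in I) open_ball_on (F (m i)) delta (c i).

Definition bowen_pre lam eps delta Z : \bar R :=
  ereal_inf [set s | exists I c m,
    covering delta eps Z I c m /\ s = family_sum lam I m].

Definition bowen_lim lam delta Z : \bar R :=
  lim (bowen_pre lam eps delta Z @[eps --> 0^'+]).

Definition htop_bowen Z delta : \bar R :=
  ereal_inf [set lam%:E | lam in
    [set lam | 0 < lam /\ bowen_lim lam delta Z = 0%E]].

Definition mdim_of (h : set X -> R -> \bar R) Z : \bar R :=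
  limf_esup (fun delta => h Z delta * ((ln delta^-1)^-1)%:E)%E 0^'+.

Definition mdim := mdim_of htop.
Definition mdimP := mdim_of htop_packing.
Definition mdimB := mdim_of htop_bowen.

Definition local_of (m : set X -> \bar R) x : \bar R :=
  ereal_inf [set m K | K in [set K | closed K /\ nbhs x K]].

Definition local_mdim := local_of mdim.
Definition local_mdimP := local_of mdimP.
Definition local_mdimB := local_of mdimB.

End mean_dimension.

(* [m] is the maximum of [f], and is attained. *)
Definition is_max_of (R : realType) (T : Type) (f : T -> \bar R) (m : \bar R) :
    Prop :=
  range f m /\ ubound (range f) m.

(* Main.v *)
From HB Require Import structures.
Require Import Defs.
From mathcomp Require Import all_boot all_order all_algebra finmap.
From mathcomp Require Import all_classical all_reals all_analysis.
From mathcomp Require Import ring lra.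

Set Implicit Arguments.
Unset Strict Implicit.
Unset Printing Implicit Defensive.

Import Order.TTheory GRing.Theory Num.Theory.
Import numFieldNormedType.Exports.

Local Open Scope classical_set_scope.
Local Open Scope ring_scope.

(* Writing h for the entropies at a fixed scale, the chain
   htop(X, 2d) <= htop_bowen(X, d),
   htop_bowen(Z, 3d) <= htop_packing(Z, d) and
   htop_packing(X, d) <= htop(X, d)
   makes the three mean dimensions agree, since a constant factor in d is
   invisible after division by log(1/d).  The last inequality counts the balls
   of each index by separated sets and sums over n, which is where
   |F_n|/log n -> oo enters; the middle one turns a maximal disjoint packing
   into a cover.

   The first one replaces measures and the variational principle by a count.
   Take finite covers of X by Bowen balls with small total weight
   sum exp(-lam |F_(n_i)|).  Every x assigns to each g in F_N a tile
   F_(n_i) g such that g x lies in the i-th ball.  By temperedness a greedy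
   choice from the largest index down extracts almost disjoint tiles filling a
   fixed proportion of F_N; repeating this with several covers, each much more
   invariant than the previous one, fills nearly all of F_N
   (Ornstein-Weiss quasi-tiling).  The chosen tiles form a code determining x up
   to 2d along F_N.  Since the sum over all codes of the product of the weights
   is at most prod (1 + w) <= exp(sum w), while each code has weight about
   exp(-lam |F_N|), there are at most exp((lam + o(1)) |F_N|) codes. *)

(** * Quasi-tilings by translates of a tempered sequence *)

Section tilings.
Variables (R : realFieldType) (G : groupType).
Implicit Types (A B E U : {fset G}).

Definition rtrans E (g : G) : {fset G} := [fset (h * g)%g | h in E]%fset.

Definition fcup (I : choiceType) (T : I -> {fset G}) (P : {fset I}) : {fset G} :=
  (\bigcup_(p <- P) T p)%fset.

Lemma card_rtrans E g : #|` rtrans E g| = #|` E|.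
Proof. by rewrite card_imfset//; exact: mulIg. Qed.

Lemma fcupP (I : choiceType) (T : I -> {fset G}) (P : {fset I}) u :
  reflect (exists2 p, p \in P & u \in T p) (u \in fcup T P).
Proof.
rewrite /fcup; apply: (iffP (bigfcupP _ _ _ _)) => [[p /andP[pP _] up]|[p pP up]]; exists p => //.
by rewrite pP.
Qed.

Lemma fcup1U (I : choiceType) (T : I -> {fset G}) (P : {fset I}) p :
  (fcup T (p |` P) = T p `|` fcup T P)%fset.
Proof.
apply/fsetP => u; rewrite in_fsetU; apply/fcupP/orP.
  move=> [q]; rewrite in_fset1U => /orP[/eqP-> ?|qP uq]; first by left.
  by right; apply/fcupP; exists q.
by move=> [up|/fcupP[q qP uq]]; [exists p|exists q];
  rewrite ?in_fset1U ?eqxx ?qP ?orbT.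
Qed.

Lemma fcupU (I : choiceType) (T : I -> {fset G}) (P Q : {fset I}) :
  (fcup T (P `|` Q) = fcup T P `|` fcup T Q)%fset.
Proof.
apply/fsetP => u; rewrite in_fsetU; apply/fcupP/orP.
  by move=> [q]; rewrite in_fsetU => /orP[] ? ?; [left|right]; apply/fcupP; exists q.
by move=> [|] /fcupP[q qP uq]; exists q => //; rewrite in_fsetU qP ?orbT.
Qed.

(* A translate is kept as long as at most the fraction [e] of it is already
   covered. *)
Lemma greedy_translates e E A : 0 <= e <= 1 ->
  exists2 B : {fset G}, (B `<=` A)%fset &
    ((1 - e) * #|` E|%:R * #|` B|%:R <= #|` fcup (rtrans E) B|%:R :> R) /\
    forall a, a \in A ->
      e * #|` E|%:R <= #|` (rtrans E a `&` fcup (rtrans E) B)%fset|%:R :> R.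
Proof.
move=> /andP[e0 e1].
elim/fset1U_rect: A => [|a A aA [B BA [cB hB]]].
  exists fset0 => //; split; last by move=> a; rewrite in_fset0.
  by rewrite cardfs0 mulr0.
have BaA : (B `<=` a |` A)%fset := fsubset_trans BA (fsubsetUr _ _).
set U := fcup (rtrans E) B in cB hB *.
have [ha|ha] := leP (e * #|` E|%:R) (#|` (rtrans E a `&` U)%fset|%:R : R).
  by exists B => //; split=> // b /fset1UP[->//|/hB].
exists (a |` B)%fset; first by rewrite fsetUS.
have aB : a \notin B by apply: contra aA => /(fsubsetP BA).
rewrite fcup1U -/U; split.
  (* Less than the fraction [e] of the new translate is already covered, so it adds more than
     [(1 - e) * #|E|] points. *)
  have := cardfsUI (rtrans E a) U; rewrite card_rtrans => /(congr1 (fun n => n%:R : R)).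
  rewrite !natrD cardfsU1 aB natrD /=; set x := #|` (_ `|` _)%fset|%:R; nra.
move=> b /fset1UP[->|/hB hb].
  by rewrite (fsetIidPl _) ?fsubsetUl// card_rtrans ler_piMl.
by apply: (le_trans hb); rewrite ler_nat fsubset_leq_card// fsetIS// fsubsetUr.
Qed.

Lemma sum_mem_fset (I : choiceType) (P : {fset I}) (p : pred I) :
  (\sum_(i <- P) p i = #|` [fset i in P | p i]%fset|)%N.
Proof.
rewrite -sum1_size big_fset/= [RHS]big_mkcond/=.
by apply: eq_bigr => i _; case: (p i).
Qed.

(** Double counting: a pair [(h, u)] in [E] times [U] determines the only [a] with [h a = u]. *)
Lemma sum_card_rtransI E A U :
  (\sum_(a <- A) #|` (rtrans E a `&` U)%fset| <= #|` E| * #|` U|)%N.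
Proof.
have le_card a : (#|` (rtrans E a `&` U)%fset| <= \sum_(h <- E) ((h * a)%g \in U))%N.
  rewrite (sum_mem_fset E (fun h => (h * a)%g \in U)).
  set Q := [fset h in E | _]%fset.
  apply: (@leq_trans #|` [fset (h * a)%g | h in Q]%fset|); last exact: leq_imfset_card.
  apply: fsubset_leq_card; apply/fsubsetP => u; rewrite in_fsetI.
  move=> /andP[/imfsetP[h/= hE ->] hU]; apply/imfsetP; exists h => //=.
  by rewrite !inE hE.
apply: (@leq_trans (\sum_(a <- A) \sum_(h <- E) ((h * a)%g \in U))%N).
  by apply: leq_sum => a _; exact: le_card.
rewrite exchange_big/= -sum1_size big_distrl/=; apply: leq_sum => h _.
rewrite mul1n (sum_mem_fset A (fun a => (h * a)%g \in U)).
set Q := [fset a in A | _]%fset.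
have <- : #|` [fset (h * a)%g | a in Q]%fset| = #|` Q|.
  by rewrite card_imfset//; exact: mulgI.
rewrite fsubset_leq_card//.
by apply/fsubsetP => _ /imfsetP[a/= + ->]; rewrite !inE => /andP[].
Qed.

Lemma single_scale_covering e E A : (E != fset0) -> 0 < e <= 1 ->
  exists2 B : {fset G}, (B `<=` A)%fset &
    (1 - e) * #|` E|%:R * #|` B|%:R <= #|` fcup (rtrans E) B|%:R :> R /\
    e * #|` A|%:R <= #|` fcup (rtrans E) B|%:R :> R.
Proof.
move=> E0 /andP[e0 e1].
have [|B BA [cB hB]] := @greedy_translates e E A; first by rewrite ltW.
exists B => //; split=> //.
have E_gt0 : 0 < #|` E|%:R :> R by rewrite ltr0n cardfs_gt0.
have : \sum_(a <- A) e * #|` E|%:R <= #|` E|%:R * #|` fcup (rtrans E) B|%:R :> R.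
  rewrite -natrM; apply: le_trans (_ : _ <= (\sum_(a <- A) _)%:R) _; last first.
    by rewrite ler_nat; exact: (sum_card_rtransI E A (fcup (rtrans E) B)).
  by rewrite natr_sum big_seq [leRHS]big_seq; apply: ler_sum => a /hB.
rewrite big_const_seq count_predT iter_addr addr0 -[leLHS]mulr_natr => H.
by rewrite -(ler_pM2l E_gt0) (le_trans _ H)// mulrCA mulrA.
Qed.

Lemma card_fcup_le (I : choiceType) (T : I -> {fset G}) (P : {fset I}) :
  (#|` fcup T P| <= \sum_(p <- P) #|` T p|)%N.
Proof.
rewrite /fcup; elim/big_rec2: _ => [|p n U _ leUn]; first by rewrite cardfs0.
by rewrite (leq_trans (leq_card_fsetU _ _).1)// leq_add2l.
Qed.

Lemma eq_fcup (I : choiceType) (T S : I -> {fset G}) (P : {fset I}) :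
  {in P, T =1 S} -> fcup T P = fcup S P.
Proof. by move=> TS; rewrite /fcup; apply: eq_big_seq. Qed.

Lemma cardfsU_disjoint (A B : {fset G}) : [disjoint A & B]%fset ->
  (#|` (A `|` B)%fset| = #|` A| + #|` B|)%N.
Proof. by move=> AB; apply/eqP; rewrite (leq_card_fsetU A B).2. Qed.

Lemma sum_fsetU_disjoint (I : choiceType) (P Q : {fset I}) (f : I -> R) :
  [disjoint P & Q]%fset ->
  \sum_(i <- (P `|` Q)%fset) f i = \sum_(i <- P) f i + \sum_(i <- Q) f i.
Proof.
move=> PQ; rewrite (big_fsetID _ (mem P))/=; congr (_ + _).
  apply: eq_fbigl => i; rewrite !inE; by case: (i \in P); rewrite ?andbF.
apply: eq_fbigl => i; rewrite !inE.
have [iP|iP] := boolP (i \in P); rewrite ?andbT//= ?andbF.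
by apply/esym/negbTE; move/fdisjointP : PQ => /(_ _ iP).
Qed.

Lemma le_sum_fsetU (I : choiceType) (P Q : {fset I}) (f : I -> R) :
  (forall i, 0 <= f i) ->
  \sum_(i <- (P `|` Q)%fset) f i <= \sum_(i <- P) f i + \sum_(i <- Q) f i.
Proof.
move=> f0; have -> : (P `|` Q = P `|` (Q `\` P))%fset.
  by apply/fsetP => q; rewrite !inE; case: (q \in P).
rewrite sum_fsetU_disjoint; last first.
  by apply/fdisjointP => q qP; rewrite inE qP.
rewrite lerD2l [leRHS](big_fsetID _ (mem P))/= ler_wpDl//; first exact: sumr_ge0.
by rewrite le_eqVlt; apply/orP; left; apply/eqP; apply: eq_fbigl => q; rewrite !inE andbC.
Qed.

Section layer.
Variables (F : nat -> {fset G}) (C e : R).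
Hypothesis F0 : forall n, F n != fset0.
Hypothesis C0 : 0 <= C.
Hypothesis temperedF : forall n,
  #|` (\bigcup_(k <- iota 0 n) [fset (g^-1 * h)%g | g in F k, h in F n])%fset|%:R
    <= C * #|` F n|%:R.
Hypothesis e01 : 0 < e < 1.

(** Induction on a bound for the tile indices, largest index first: centres of index [m] are covered
    greedily, then the induction hypothesis treats centres of smaller index whose tile avoids what
    is covered. The two unions are disjoint, so both estimates add up. *)
Lemma layer_covering_bounded m (n : G -> nat) A :
  (forall a, a \in A -> (n a < m)%N) ->
  exists2 B : {fset G}, (B `<=` A)%fset &
    let U := fcup (fun b => rtrans (F (n b)) b) B in
    (1 - e) * \sum_(b <- B) #|` F (n b)|%:R <= #|` U|%:R /\
    #|` A|%:R <= (e^-1 + C / (1 - e)) * #|` U|%:R.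
Proof.
have /andP[e0 e1] := e01.
pose T b := rtrans (F (n b)) b.
elim: m A => [|m IH] A nA.
  exists fset0 => //=; rewrite big_nil mulr0; split=> //.
  have [->|[a /nA//]] := fset_0Vmem A.
  by rewrite cardfs0 mulr_ge0// addr_ge0 ?divr_ge0 ?invr_ge0// ?subr_ge0 ltW.
pose At := [fset a in A | n a == m]%fset.
have [|B1 B1At [cB1 cAt]] := @single_scale_covering e (F m) At (F0 m).
  by rewrite e0 ltW.
have nB1 b : b \in B1 -> n b = m.
  by move=> /(fsubsetP B1At); rewrite !inE => /andP[_ /eqP].
have UE : fcup (rtrans (F m)) B1 = fcup T B1.
  by apply: eq_fcup => b /nB1 nb; rewrite /T nb.
rewrite {}UE in cB1 cAt; set U1 := fcup T B1 in cB1 cAt.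
pose Al := [fset a in A | (n a < m)%N && [disjoint T a & U1]%fset]%fset.
have [|B2 B2Al /= [cB2 cAl]] := IH Al; first by move=> a; rewrite !inE => /and3P[].
rewrite -/T in cB2 cAl; set U2 := fcup T B2 in cB2 cAl.
have dU : [disjoint U1 & U2]%fset.
  rewrite fdisjoint_sym; apply/fdisjointP => u /fcupP[b /(fsubsetP B2Al)].
  by rewrite !inE => /and3P[_ _ /fdisjointP h] /h.
have dB : [disjoint B1 & B2]%fset.
  apply/fdisjointP => b /nB1 nb; apply/negP => /(fsubsetP B2Al).
  by rewrite !inE nb ltnn andbF.
exists (B1 `|` B2)%fset.
  rewrite fsubUset; apply/andP; split; apply/fsubsetP => b.
    by move=> /(fsubsetP B1At); rewrite !inE => /andP[].
  by move=> /(fsubsetP B2Al); rewrite !inE => /andP[].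
rewrite /= fcupU -/T -/U1 -/U2 cardfsU_disjoint// natrD.
have sB1 : \sum_(b <- B1) #|` F (n b)|%:R = #|` F m|%:R * #|` B1|%:R :> R.
  rewrite (eq_big_seq (fun=> #|` F m|%:R)) => [|b /nB1->//].
  by rewrite big_const_seq count_predT iter_addr addr0 mulr_natr.
rewrite sum_fsetU_disjoint// sB1; split; first by rewrite mulrDr lerD// mulrA.
(* A smaller tile at [a] that meets a chosen tile at [b] gives [h a = f b], so [a = h^-1 f b] lies
   in [D b]. Temperedness bounds [#|D|] by [C * #|F m|], so the discarded centres are charged to the
   tiles already chosen. *)
pose D := (\bigcup_(k <- iota 0 m) [fset (g^-1 * h)%g | g in F k, h in F m])%fset.
have AU : (A `<=` At `|` fcup (rtrans D) B1 `|` Al)%fset.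
  apply/fsubsetP => a aA; rewrite 2!in_fsetU.
  have := nA _ aA; rewrite ltnS leq_eqVlt => /orP[/eqP nam|nam].
    by rewrite !inE aA nam eqxx.
  have [dTa|] := boolP [disjoint T a & U1]%fset; first by rewrite !inE aA nam dTa !orbT.
  rewrite -fsetI_eq0 => /fset0Pn[u /fsetIP[/imfsetP[h/= hF uh]]].
  move=> /fcupP[b bB1 /imfsetP[f/= fF uf]].
  apply/orP; left; apply/orP; right; apply/fcupP; exists b => //.
  apply/imfsetP; exists (h^-1 * f)%g => /=; last by rewrite -mulgA -uf uh mulKg.
  apply/bigfcupP; exists (n a); first by rewrite mem_iota nam.
  by apply/imfset2P; exists h => //; exists f => //; rewrite -(nB1 _ bB1).
have cD : #|` fcup (rtrans D) B1|%:R <= C * #|` F m|%:R * #|` B1|%:R :> R.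
  apply: (@le_trans _ _ (\sum_(b <- B1) #|` D|%:R)).
    rewrite -natr_sum ler_nat (leq_trans (card_fcup_le _ _))//.
    by apply: leq_sum => b _; rewrite card_rtrans.
  rewrite big_const_seq count_predT iter_addr addr0 -[leLHS]mulr_natr.
  by rewrite ler_wpM2r//; exact: temperedF.
have cA : #|` A|%:R <= #|` At|%:R + #|` fcup (rtrans D) B1|%:R + #|` Al|%:R :> R.
  rewrite -!natrD ler_nat (leq_trans (fsubset_leq_card AU))//.
  rewrite (leq_trans (leq_card_fsetU _ _).1)// leq_add2r.
  exact: (leq_card_fsetU _ _).1.
apply: (le_trans cA); rewrite mulrDr lerD//.
rewrite mulrDl lerD//; first by rewrite -(ler_pM2l e0) mulrA divff ?gt_eqF// mul1r.
apply: (le_trans cD); rewrite -!mulrA ler_wpM2l// ler_pdivlMl ?subr_gt0//.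
by rewrite mulrA.
Qed.

Lemma layer_covering (n : G -> nat) A :
  exists2 B : {fset G}, (B `<=` A)%fset &
    let U := fcup (fun b => rtrans (F (n b)) b) B in
    (1 - e) * \sum_(b <- B) #|` F (n b)|%:R <= #|` U|%:R /\
    #|` A|%:R <= (e^-1 + C / (1 - e)) * #|` U|%:R.
Proof.
apply: (@layer_covering_bounded (\max_(a <- A) n a).+1) => a aA.
by rewrite ltnS; apply: leq_bigmax_seq.
Qed.

End layer.

End tilings.

(** * Filling the gaps of earlier tiles by one more layer *)

Section layer_step.
Variables (R : realFieldType) (G : groupType) (V : choiceType) (nu : V -> nat).
Variables (F : nat -> {fset G}) (C e : R).
Hypothesis F0 : forall n, F n != fset0.
Hypothesis C0 : 0 <= C.
Hypothesis temperedF : forall n,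
  #|` (\bigcup_(k <- iota 0 n) [fset (g^-1 * h)%g | g in F k, h in F n])%fset|%:R
    <= C * #|` F n|%:R.
Hypothesis e01 : 0 < e < 1.
Implicit Types (K E : {fset G}) (P Q : {fset G * V}).

(** The points [g] outside [E] for which [K g] meets [E]. *)
Definition outer_boundary K E : {fset G} :=
  ([fset (k^-1 * h)%g | k in K, h in E] `\` E)%fset.

Definition inner_boundary K E : {fset G} :=
  [fset g in E | ~~ (rtrans K g `<=` E)%fset]%fset.

Definition tile (p : G * V) : {fset G} := rtrans (F (nu p.2)) p.1.

(** Inverse of the constant of [layer_covering]: one layer covers at least this many points per
    available centre. *)
Definition coverage_rate : R := (e^-1 + C / (1 - e))^-1.

Lemma coverage_rate_gt0 : 0 < coverage_rate.
Proof.
have /andP[e0 e1] := e01.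
by rewrite invr_gt0 ltr_pwDl ?invr_gt0// divr_ge0// subr_ge0 ltW.
Qed.

Lemma coverage_rate_le1 : coverage_rate <= 1.
Proof.
have /andP[e0 e1] := e01.
have d0 : 0 <= C / (1 - e) by rewrite divr_ge0// subr_ge0 ltW.
have i1 : 1 <= e^-1 by rewrite invf_ge1// ltW.
by rewrite invf_le1; lra.
Qed.

(** [P] holds the tiles placed before, and [tau] offers at each [g] a tile inside [K g]. Centres of
    the gap whose [K g] leaves the gap lie near the boundary of [S] or of a tile of [P], and
    invariance makes them few. The new layer removes the fraction [coverage_rate] of the gap, up to
    this boundary error. *)
Lemma layer_step (eta : R) S K P (tau : G -> V) :
  0 <= eta ->
  (fcup tile P `<=` S)%fset ->
  (1 - e) * \sum_(p <- P) #|` F (nu p.2)|%:R <= #|` fcup tile P|%:R ->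
  (forall g, F (nu (tau g)) `<=` K)%fset ->
  (forall p, p \in P ->
    #|` outer_boundary K (F (nu p.2))|%:R <= eta * #|` F (nu p.2)|%:R) ->
  #|` inner_boundary K S|%:R <= eta * #|` S|%:R ->
  exists Q, [/\ forall q, q \in Q -> q \in P \/ (q.1 \in S /\ q.2 = tau q.1),
    (fcup tile Q `<=` S)%fset,
    (1 - e) * \sum_(q <- Q) #|` F (nu q.2)|%:R <= #|` fcup tile Q|%:R &
    #|` S|%:R - #|` fcup tile Q|%:R <=
      (1 - coverage_rate) * (#|` S|%:R - #|` fcup tile P|%:R)
      + coverage_rate * (eta * (1 + (1 - e)^-1) * #|` S|%:R)].
Proof.
move=> eta0 PS wP tauK PK SK; have /andP[e0 e1] := e01.
set U := fcup tile P in PS wP *.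
pose A := [fset g in (S `\` U)%fset | (rtrans K g `<=` S `\` U)%fset]%fset.
have [B BA [wB cA]] := layer_covering F0 C0 temperedF e01 (nu \o tau) A.
pose PB : {fset G * V} := [fset (b, tau b) | b in B]%fset.
have injB : injective (fun b => (b, tau b)) by move=> b b' [].
have fcupPB : fcup tile PB = fcup (fun b => rtrans (F (nu (tau b))) b) B.
  by rewrite /fcup (perm_big _ (enum_imfset _ _))//= ?big_map// => b b' _ _ [].
have sumPB : \sum_(q <- PB) #|` F (nu q.2)|%:R = \sum_(b <- B) #|` F (nu (tau b))|%:R :> R.
  by rewrite (perm_big _ (enum_imfset _ _))//= ?big_map// => b b' _ _ [].
set W := fcup _ B in wB cA; rewrite -/W in fcupPB.
have WS : (W `<=` S `\` U)%fset.
  apply/fsubsetP => u /fcupP[b /(fsubsetP BA)]; rewrite !inE => /andP[_ /fsubsetP h].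
  move=> /imfsetP[f/= fF ->]; have := h (f * b)%g; rewrite !inE; apply.
  by apply/imfsetP; exists f => //; exact: (fsubsetP (tauK b)).
have dUW : [disjoint U & W]%fset.
  by rewrite fdisjoint_sym; apply/fdisjointP => u /(fsubsetP WS); rewrite inE => /andP[].
have cU : #|` S|%:R = #|` U|%:R + #|` (S `\` U)%fset|%:R :> R.
  by rewrite -natrD -(cardfsID U S) (fsetIidPr PS).
(* A gap point [g] outside [A] has some [k g] outside the gap: either outside [S], and [g] is in the
   inner boundary, or in a tile of [P] that misses [g], and [g] is in its outer boundary. *)
have cover_S : (S `\` U `<=` A `|` inner_boundary K S `|`
    fcup (fun p => rtrans (outer_boundary K (F (nu p.2))) p.1) P)%fset.
  apply/fsubsetP => g gSU; rewrite 2!in_fsetU.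
  have [gA|gA] := boolP (g \in A) => //=.
  have [//|gi/=] := boolP (g \in inner_boundary K S).
  have : ~~ (rtrans K g `<=` S `\` U)%fset
    by apply: contra gA => gK; move: gSU; rewrite !inE => /andP[-> ->].
  move: gSU; rewrite inE => /andP[gU gS].
  move: gi; rewrite inE/= inE/= gS negbK => /fsubsetP gi.
  move=> /fsubsetPn[u uKg]; rewrite inE gi// andbT negbK => /fcupP[p pP].
  move: uKg => /imfsetP[k/= kK ->] /imfsetP[h/= hF kg].
  apply/fcupP; exists p => //; apply/imfsetP; exists (k^-1 * h)%g => /=; last first.
    by rewrite -mulgA -kg mulKg.
  rewrite inE; apply/andP; split; last by apply/imfset2P; exists k => //; exists h.
  apply: contra gU => kh; apply/fcupP; exists p => //; apply/imfsetP.
  by exists (k^-1 * h)%g => //=; rewrite -mulgA -kg mulKg.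
(* The boundaries are charged to the total size of the tiles, which almost disjointness bounds by
   [#|S| / (1 - e)]. *)
have c3 : #|` fcup (fun p => rtrans (outer_boundary K (F (nu p.2))) p.1) P|%:R <=
    eta * ((1 - e)^-1 * #|` S|%:R) :> R.
  apply: (@le_trans _ _ (\sum_(p <- P) eta * #|` F (nu p.2)|%:R)).
    apply: (@le_trans _ _ (\sum_(p <- P) #|` outer_boundary K (F (nu p.2))|%:R)).
      rewrite -natr_sum ler_nat (leq_trans (card_fcup_le _ _))//.
      by apply: leq_sum => b _; rewrite card_rtrans.
    by rewrite big_seq [leRHS]big_seq; apply: ler_sum => p /PK.
  rewrite -mulr_sumr ler_wpM2l// ler_pdivlMl ?subr_gt0//.
  by rewrite (le_trans wP)// ler_nat fsubset_leq_card.
have cR : #|` (S `\` U)%fset|%:R <= #|` A|%:R + eta * (1 + (1 - e)^-1) * #|` S|%:R :> R.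
  have : #|` (S `\` U)%fset|%:R <= #|` A|%:R + #|` inner_boundary K S|%:R +
      #|` fcup (fun p => rtrans (outer_boundary K (F (nu p.2))) p.1) P|%:R :> R.
    rewrite -!natrD ler_nat (leq_trans (fsubset_leq_card cover_S))//.
    rewrite (leq_trans (leq_card_fsetU _ _).1)// leq_add2r.
    exact: (leq_card_fsetU _ _).1.
  by move: SK c3; rewrite -[eta * _ * _]mulrA mulrDl mul1r mulrDr; lra.
have cW : coverage_rate * #|` A|%:R <= #|` W|%:R :> R.
  by rewrite ler_pdivrMl// -invr_gt0; exact: coverage_rate_gt0.
exists (P `|` PB)%fset; rewrite fcupU fcupPB -/U; split.
- move=> q; rewrite inE => /orP[|/imfsetP[b/= bB ->]]; first by left.
  by right; split=> //; move/(fsubsetP BA) : bB; rewrite !inE => /andP[/andP[]].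
- by rewrite fsubUset PS (fsubset_trans WS)// fsubsetDl.
- rewrite cardfsU_disjoint// natrD.
  apply: (@le_trans _ _ ((1 - e) * (\sum_(q <- P) #|` F (nu q.2)|%:R +
      \sum_(q <- PB) #|` F (nu q.2)|%:R))).
    apply: ler_wpM2l; first by rewrite subr_ge0 ltW.
    exact: le_sum_fsetU.
  by rewrite mulrDr sumPB lerD.
- rewrite cardfsU_disjoint// natrD; move: cR cW.
  have := coverage_rate_gt0; set r := coverage_rate => r0.
  set x := eta * _ * _ => cR cW; rewrite cU.
  have : r * #|` (S `\` U)%fset|%:R <= r * (#|` A|%:R + x) by rewrite ler_pM2l.
  lra.
Qed.

End layer_step.

(** * Counting codes *)

Section codes.
Variable R : realType.

(** Expanding the product gives the weights of all subsets of [Q], and distinct elements of [H] have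
    distinct codes. The induction separates codes by whether they contain the new element [q]. *)
Lemma sum_prod_codes (I T : choiceType) (w : T -> R) (Q : {fset T}) :
  (forall t, 0 <= w t) ->
  forall (H : {fset I}) (code : I -> {fset T}),
  {in H &, injective code} -> (forall x, x \in H -> (code x `<=` Q)%fset) ->
  \sum_(x <- H) \prod_(t <- code x) w t <= \prod_(t <- Q) (1 + w t).
Proof.
move=> w0; elim/fset1U_rect: Q => [|q Q qQ IH] H code injc codeQ.
  have code0 x : x \in H -> code x = fset0.
    by move=> /codeQ; rewrite fsubset0 => /eqP.
  rewrite big_seq_fset0 (eq_big_seq (fun=> 1)) => [|x /code0->]; last first.
    by rewrite big_seq_fset0.
  rewrite big_const_seq count_predT iter_addr addr0 -[leRHS]mulr1n ler_nat.
  have [->|[x xH]] := fset_0Vmem H; first by rewrite cardfs0.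
  rewrite -(cardfs1 x) fsubset_leq_card//; apply/fsubsetP => y yH.
  by rewrite in_fset1; apply/eqP; apply: injc => //; rewrite !code0.
rewrite (big_fsetID _ (fun x => q \in code x))/= big_fsetU1//= mulrDl mul1r addrC.
apply: lerD.
  apply: IH => [x y|x]; rewrite !inE => /andP[xH qx].
    by move=> /andP[yH qy]; exact: injc.
  apply/fsubsetP => t tx; have := fsubsetP (codeQ _ xH) _ tx.
  by rewrite !inE => /orP[/eqP tq|//]; rewrite tq (negbTE qx) in tx.
set H1 := [fset x in H | _]%fset.
have H1P x : x \in H1 -> x \in H /\ q \in code x by rewrite !inE => /andP[].
rewrite (eq_big_seq (fun x => w q * \prod_(t <- (code x `\ q)%fset) w t)); last first.
  by move=> x /H1P[_ qx]; rewrite (big_fsetD1 q).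
rewrite -mulr_sumr ler_wpM2l//.
apply: (IH H1 (fun x => code x `\ q)%fset) => [x y /H1P[xH qx] /H1P[yH qy] xy|x /H1P[xH qx]].
  by apply: injc => //; rewrite -(fsetD1K qx) xy fsetD1K.
apply/fsubsetP => t; rewrite !inE => /andP[tq tx]; have := fsubsetP (codeQ _ xH) _ tx.
by rewrite !inE (negbTE tq).
Qed.

(** Each code has weight at least [expR (- b)], and [1 + u <= expR u] bounds the total weight by the
    exponential of a sum. *)
Lemma card_codes (I T : choiceType) (c : T -> R) (Q : {fset T}) (H : {fset I})
    (code : I -> {fset T}) b :
  {in H &, injective code} -> (forall x, x \in H -> (code x `<=` Q)%fset) ->
  (forall x, x \in H -> \sum_(t <- code x) c t <= b) ->
  #|` H|%:R <= expR (b + \sum_(t <- Q) expR (- c t)).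
Proof.
move=> injc codeQ cb.
have := @sum_prod_codes I T (fun t => expR (- c t)) Q (fun t => expR_ge0 _) H code injc codeQ.
have /le_trans leL : #|` H|%:R * expR (- b) <= \sum_(x <- H) \prod_(t <- code x) expR (- c t).
  have -> : #|` H|%:R * expR (- b) = \sum_(x <- H) expR (- b).
    by rewrite big_const_seq count_predT iter_addr addr0 mulr_natl.
  rewrite big_seq [leRHS]big_seq; apply: ler_sum => x /cb xb.
  by rewrite -expR_sum ler_expR sumrN lerN2.
have leR : \prod_(t <- Q) (1 + expR (- c t)) <= expR (\sum_(t <- Q) expR (- c t)).
  rewrite expR_sum; apply: ler_prod => t _.
  by rewrite expR_ge1Dx andbT addr_ge0// expR_ge0.
move=> /leL/le_trans/(_ leR); rewrite expRN ler_pdivrMr ?expR_gt0//.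
by rewrite expRD mulrC.
Qed.

End codes.

(** * Invariance of Folner sets under a finite window *)

Section folner_invariance.
Variables (R : realType) (G : groupType) (F : nat -> {fset G}).
Hypothesis F_folner : folner R F.
Implicit Types (K E : {fset G}).

Lemma folner_neq0 n : F n != fset0.
Proof. by have [] := F_folner. Qed.

Lemma folner_card_gt0 n : 0 < #|` F n|%:R :> R.
Proof. by rewrite ltr0n cardfs_gt0 folner_neq0. Qed.

Lemma folner_translate (K : {fset G}) (eta : R) : 0 < eta ->
  \forall n \near \oo, forall g, g \in K ->
    #|` F n|%:R - #|` (F n `&` [fset (g * h)%g | h in F n])%fset|%:R
      <= eta * #|` F n|%:R.
Proof.
move=> eta0; have [_ hF] := F_folner.
have : \forall n \near \oo, (\bigcap_(g in [set` K]) [set n |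
    #|` F n|%:R - #|` (F n `&` [fset (g * h)%g | h in F n])%fset|%:R
      <= eta * #|` F n|%:R]) n.
  apply: filter_bigI => g _.
  have /cvgrPdist_le/(_ _ eta0) := hF g; apply: filterS => n /= h.
  have F0 := folner_card_gt0 n.
  have := le_trans (ler_norm _) h.
  by rewrite -ler_pdivrMr// mulrBl divff ?gt_eqF.
by apply: filterS => n /= h g gK; exact: h.
Qed.

(** Each boundary is a union over [k] in [K] of sets as large as the part of [F n] displaced by [k]
    or [k^-1], so the tolerance is divided among the elements of [K]. *)
Lemma folner_boundary (K : {fset G}) (eta : R) : 0 < eta ->
  \forall n \near \oo,
    #|` outer_boundary K (F n)|%:R <= eta * #|` F n|%:R /\
    #|` inner_boundary K (F n)|%:R <= eta * #|` F n|%:R.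
Proof.
(* The inverses serve the outer boundary; the [+ 1] below keeps the divisor positive for empty
   [K]. *)
move=> eta0; pose K' := (K `|` [fset k^-1%g | k in K])%fset.
have c0 : 0 < #|` K|%:R + 1 :> R by rewrite ltr_wpDl.
have eta0' : 0 < eta / (#|` K|%:R + 1) by rewrite divr_gt0.
have sumK n (f : G -> {fset G}) :
    (forall g, g \in K -> #|` f g|%:R <= eta / (#|` K|%:R + 1) * #|` F n|%:R) ->
    #|` fcup f K|%:R <= eta * #|` F n|%:R.
  move=> fK; apply: (@le_trans _ _ (\sum_(g <- K) #|` f g|%:R)).
    by rewrite -natr_sum ler_nat card_fcup_le.
  apply: (@le_trans _ _ (\sum_(g <- K) eta / (#|` K|%:R + 1) * #|` F n|%:R)).
    by rewrite big_seq [leRHS]big_seq; apply: ler_sum => g /fK.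
  rewrite big_const_seq count_predT iter_addr addr0 -[leLHS]mulr_natl mulrA.
  rewrite ler_wpM2r// mulrCA; apply: ler_piMr; first exact: ltW.
  by rewrite ler_pdivrMr// mul1r; lra.
have := folner_translate K' eta0'; apply: filterS => n hn.
split.
  apply: le_trans (sumK n (fun g => [fset (g^-1 * h)%g | h in F n] `\` F n)%fset _).
    rewrite ler_nat fsubset_leq_card//; apply/fsubsetP => u; rewrite !inE.
    move=> /andP[uF /imfset2P[k/= kK [h/= hF uE]]]; apply/fcupP; exists k => //.
    by rewrite inE uF; apply/imfsetP; exists h.
  move=> g gK; have /hn : (g^-1)%g \in K'.
    by rewrite inE; apply/orP; right; apply/imfsetP; exists g.
  apply: le_trans; rewrite lerBrDr -natrD ler_nat.
  have <- : #|` [fset (g^-1 * h)%g | h in F n]%fset| = #|` F n|.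
    by rewrite card_imfset//; exact: mulgI.
  by rewrite addnC fsetIC cardfsID.
apply: le_trans (sumK n (fun g => [fset h in F n | (g * h)%g \notin F n])%fset _).
  rewrite ler_nat fsubset_leq_card//; apply/fsubsetP => u; rewrite inE/= inE/=.
  move=> /andP[uF /fsubsetPn[_ /imfsetP[k/= kK ->] ku]].
  by apply/fcupP; exists k => //; rewrite !inE uF.
move=> g gK; have /hn : g \in K' by rewrite inE gK.
apply: le_trans; rewrite lerBrDr -natrD ler_nat.
have -> : #|` F n| = #|` [fset (g * h)%g | h in F n]%fset|.
  by rewrite card_imfset//; exact: mulgI.
rewrite -(cardfsID (F n) [fset (g * h)%g | h in F n]%fset) fsetIC addnC leq_add2l.
set Q := [fset h in F n | _]%fset.
have <- : #|` [fset (g * h)%g | h in Q]%fset| = #|` Q|.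
  by rewrite card_imfset//; exact: mulgI.
rewrite fsubset_leq_card//; apply/fsubsetP => _ /imfsetP[h/= + ->].
rewrite !inE => /andP[hF ->]; apply/imfsetP; by exists h.
Qed.

End folner_invariance.

(** * Codes made of several layers of tiles *)

Section layers.
Variables (R : realType) (G : groupType) (X : choiceType).
Variables (act : G -> X -> X) (F : nat -> {fset G}).
Variables (V : choiceType) (nu : V -> nat) (O : V -> set X) (w : V -> R).
Hypothesis F_folner : folner R F.
Hypothesis F_tempered : tempered R F.
Hypothesis w0 : forall v, 0 <= w v.
Hypothesis light_covers : forall (L : nat) (eta : R), 0 < eta ->
  exists2 W : {fset V}, (forall v, v \in W -> (L <= nu v)%N) &
    \sum_(v <- W) w v <= eta /\ forall x, exists2 v, v \in W & O v x.

(* A code of [x] in [S]: tiles [F (nu v) * g] inside [S] such that [act g x]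
   lies in [O v], hence [act _ x] is controlled along the whole tile. *)
Definition is_code (W : {fset V}) (e : R) (S : {fset G}) x (P : {fset G * V}) :=
  [/\ forall p, p \in P -> [/\ p.1 \in S, p.2 \in W & O p.2 (act p.1 x)],
    (fcup (tile nu F) P `<=` S)%fset &
    (1 - e) * \sum_(p <- P) #|` F (nu p.2)|%:R <= #|` fcup (tile nu F) P|%:R].

(** Induction on the number of layers, with [K] kept general. The indices of a first cover [W1] are
    so large that its sets are invariant under [K]; the other layers come from the induction
    hypothesis for [K] enlarged by all sets of [W1]. In [F N] these more invariant tiles are placed
    first and [W1] fills their gaps. The rate [r] depends only on [e] and the temperedness
    constant. *)
Lemma layered_codes (e : R) : 0 < e < 1 ->
  exists2 r : R, 0 < r <= 1 &
  forall (eta eta0 : R), 0 < eta -> 0 < eta0 ->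
  forall (M : nat) (K : {fset G}), exists2 W : {fset V},
    \sum_(v <- W) w v <= M%:R * eta0 /\
    (forall v, v \in W ->
      #|` outer_boundary K (F (nu v))|%:R <= eta * #|` F (nu v)|%:R) &
    \forall N \near \oo, forall x, exists2 P, is_code W e (F N) x P &
      #|` F N|%:R - #|` fcup (tile nu F) P|%:R <=
        ((1 - r) ^+ M + eta * (1 + (1 - e)^-1)) * #|` F N|%:R.
Proof.
move=> e01; have [C C0 hC] := F_tempered.
have temperedF n :
  #|` (\bigcup_(k <- iota 0 n) [fset (g^-1 * h)%g | g in F k, h in F n])%fset|%:R
    <= C * #|` F n|%:R.
  case: n => [|n]; last exact: hC.
  by rewrite big_nil cardfs0 mulr_ge0// ltW.
set r := coverage_rate C e; exists r.
  by rewrite (coverage_rate_gt0 (ltW C0) e01) (coverage_rate_le1 (ltW C0) e01).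
have r_gt0 : 0 < r := coverage_rate_gt0 (ltW C0) e01.
have r_le1 : r <= 1 := coverage_rate_le1 (ltW C0) e01.
have /andP[e0 e1] := e01.
have e'0 : 0 <= (1 - e)^-1 by rewrite invr_ge0 subr_ge0 ltW.
move=> eta eta0 eta_gt0 eta0_gt0; elim=> [|M IH] K.
  exists fset0; first by rewrite big_seq_fset0 mul0r; split.
  apply: nearW => N x; exists fset0.
    split=> //; first by rewrite /fcup big_seq_fset0 fsub0set.
    by rewrite big_seq_fset0 mulr0.
  rewrite /fcup big_seq_fset0 cardfs0 subr0 expr0 ler_peMl//.
  by rewrite lerDl mulr_ge0 ?addr_ge0// ltW.
have [L _ hL] := folner_boundary F_folner K eta_gt0.
have [W1 W1L [wW1 W1x]] := light_covers L eta0_gt0.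
pose K1 := fcup (F \o nu) W1.
have [W2 [wW2 W2K] hW2] := IH (K `|` K1)%fset.
have outerS A E (K2 : {fset G}) : (A `<=` K2)%fset ->
    (#|` outer_boundary A E| <= #|` outer_boundary K2 E|)%N.
  move=> AK; rewrite fsubset_leq_card//; apply/fsubsetP => u; rewrite !inE.
  move=> /andP[-> /imfset2P[k/= kA [h/= hE ->]]]; apply/imfset2P.
  by exists k; [exact: (fsubsetP AK)|exists h].
exists (W1 `|` W2)%fset.
  split; last first.
    move=> v; rewrite inE => /orP[/W1L/hL[]//|/W2K]; apply: le_trans.
    by rewrite ler_nat outerS// fsubsetUl.
  by rewrite (le_trans (le_sum_fsetU W1 W2 w0))// -natr1 mulrDl mul1r addrC lerD.
have := folner_boundary F_folner K1 eta_gt0; apply: filterS2 hW2 => N hN [_ SK] x.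
have [P [Px PS wP] cP] := hN x.
(* [tau] selects a ball of [W1] containing [act g x], so each tile it offers is legitimate in a code
   of [x]. *)
have /choice[tau tauP] : forall g, exists v, v \in W1 /\ O v (act g x).
  by move=> g; have [v] := W1x (act g x); exists v.
have [g|p pP|//|Q [Q1 QS wQ cQ]] := layer_step (folner_neq0 F_folner) (ltW C0)
    temperedF e01 (tau := tau) (K := K1) (ltW eta_gt0) PS wP.
- apply/fsubsetP => h hF; apply/fcupP; exists (tau g) => //=.
  by have [] := tauP g.
- have [_ /W2K + _] := Px _ pP; apply: le_trans.
  by rewrite ler_nat outerS// fsubsetUr.
- exists Q.
    split=> // q /Q1[/Px[qS qW Oq]|[qS ->]]; first by split=> //; rewrite inE qW orbT.
    by have [tW tO] := tauP q.1; split=> //; rewrite inE tW.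
  (* The boundary error [y] is a fixed point of [t => (1 - r) t + r y], so it does not accumulate
     over the layers. *)
  apply: (le_trans cQ); move: cP; rewrite -/r exprS.
  set y := eta * _; set z := (1 - r) ^+ M => cP.
  have : (1 - r) * (#|` F N|%:R - #|` fcup (tile nu F) P|%:R) <=
     (1 - r) * ((z + y) * #|` F N|%:R) by rewrite ler_wpM2l// subr_ge0.
  by set a := #|` fcup _ _|%:R; set b := #|` F N|%:R; lra.
Qed.

End layers.

(** * Bowen metrics and finite covers *)

Section dist_on.
Variables (R : realType) (G : groupType) (X : metricType R) (act : G -> X -> X).
Implicit Types (E : {fset G}) (x y z : X) (d : R).

Lemma mdist_le_dist_on E g x y : g \in E ->
  mdist (act g x) (act g y) <= dist_on act E x y.
Proof. by move=> gE; apply: (le_bigmax_seq _ g). Qed.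

Lemma dist_on_le E x y d : 0 <= d ->
  (forall g, g \in E -> mdist (act g x) (act g y) <= d) -> dist_on act E x y <= d.
Proof.
by move=> d0 h; rewrite /dist_on big_seq; apply: bigmax_le.
Qed.

Lemma dist_on_ge0 E x y : 0 <= dist_on act E x y.
Proof.
rewrite /dist_on; elim/big_ind: _ => // [a b a0 b0|g _]; last exact: mdist_ge0.
by rewrite le_max a0.
Qed.

Lemma dist_on_sym E x y : dist_on act E x y = dist_on act E y x.
Proof. by apply: eq_bigr => g _; rewrite metric_sym. Qed.

Lemma dist_on_triangle E y x z :
  dist_on act E x z <= dist_on act E x y + dist_on act E y z.
Proof.
apply: dist_on_le => [|g gE]; first by rewrite addr_ge0// dist_on_ge0.
by rewrite (le_trans (metric_triangle _ (act g y) _))// lerD// mdist_le_dist_on.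
Qed.

Lemma dist_onxx E x : dist_on act E x x = 0.
Proof.
apply/eqP; rewrite eq_le dist_on_ge0 andbT; apply: dist_on_le => // g _.
by rewrite mdistxx.
Qed.

(** [compact_cover] concerns pointed spaces, so a nonempty [T] is first equipped with a point; an
    empty [T] is covered by the empty family. *)
Lemma compact_open_cover (T : topologicalType) : compact [set: T] ->
  cover_compact [set: T].
Proof.
move=> cT; have [[x _]|/forallNP T0] := pselect (exists x : T, True); last first.
  by move=> I D f _ _; exists fset0 => // x; have := T0 x.
case: T cT x => T [? ? ? ? ?] cT x.
set T' := Topological.Pack _ in cT x *.
pose pT : ptopologicalType := HB.pack T' (isPointed.Build T' x).
by have := cT; rewrite (@compact_cover pT).
Qed.

Lemma compact_finite_net d : compact [set: X] -> 0 < d ->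
  exists Z : {fset X}, forall x, exists2 z, z \in Z & mdist z x < d.
Proof.
move=> /compact_open_cover cX d0.
have [|x _|Z _ ZX] := cX X setT (fun z => (ball z d)^°).
- by move=> z _; exact: open_interior.
- by exists x => //; exact: nbhsx_ballx.
- exists Z => x; have [//|z zZ /interior_subset] := ZX x.
  by rewrite ballEmdist => zx; exists z.
Qed.

End dist_on.

(** * Counting separated sets by codes *)

Section separated_codes.
Variables (R : realType) (G : groupType) (X : metricType R).
Variables (act : G -> X -> X) (F : nat -> {fset G}).
Hypothesis X_compact : compact [set: X].
Hypothesis actM : forall g h x, act (g * h)%g x = act g (act h x).
Hypothesis F_folner : folner R F.
Hypothesis F_tempered : tempered R F.
Variables (lam delta : R).
Hypotheses (lam_gt0 : 0 < lam) (delta_gt0 : 0 < delta).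

Let V := (nat * X)%type.
Let O (v : V) : set X := open_ball_on act (F v.1) delta v.2.
Let w (v : V) : R := expR (- lam * #|` F v.1|%:R).

Hypothesis light_covers : forall (L : nat) (eta : R), 0 < eta ->
  exists2 W : {fset V}, (forall v, v \in W -> (L <= v.1)%N) &
    \sum_(v <- W) w v <= eta /\ forall x, exists2 v, v \in W & O v x.

Lemma sum_fsetM_snd (I J : choiceType) (A : {fset I}) (B : {fset J}) (f : J -> R) :
  \sum_(p <- (A `*` B)%fset) f p.2 = #|` A|%:R * \sum_(b <- B) f b.
Proof.
rewrite big_imfset2/=; last by move=> [? ?] [? ?] _ _ /= [-> ->].
by rewrite big_const_seq count_predT iter_addr addr0 mulr_natl.
Qed.

(** The code of [x] lists its tiles, each at cost [lam * #|F n|], and for each uncovered [g] a point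
    of the net [Z] near [act g x], at cost [s]. Per element of [F N] the tiles cost at most
    [lam / (1 - e)] and the rest at most [s * rho]; the weights of the whole alphabet [Q] give the
    last term of the exponent. *)
Lemma separated_bound (N : nat) (W : {fset V}) (Z : {fset X}) (e rho s : R)
    (H : {fset X}) : 0 < e < 1 -> 0 <= s ->
  (forall x, exists2 z, z \in Z & mdist z x < delta) ->
  (forall x, exists2 P, is_code act F fst O W e (F N) x P &
      #|` F N|%:R - #|` fcup (tile fst F) P|%:R <= rho * #|` F N|%:R) ->
  delta_separated act (F N) (2 * delta) H ->
  #|` H|%:R <= expR ((lam / (1 - e) + s * rho +
    (\sum_(v <- W) w v + #|` Z|%:R * expR (- s))) * #|` F N|%:R).
Proof.
move=> /andP[e0 e1] s0 netZ codeW sepH.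
have /choice[P PP] : forall x, exists P, is_code act F fst O W e (F N) x P /\
      #|` F N|%:R - #|` fcup (tile fst F) P|%:R <= rho * #|` F N|%:R.
  by move=> x; have [P] := codeW x; exists P.
have /choice[z zP] : forall x, exists z, z \in Z /\ mdist z x < delta.
  by move=> x; have [z] := netZ x; exists z.
set S := F N in codeW PP sepH *.
pose rest x := (S `\` fcup (tile fst F) (P x))%fset.
pose T := ((G * V) + (G * X))%type.
pose code x : {fset T} := ([fset inl p | p in P x] `|`
  [fset inr (g, z (act g x)) | g in rest x])%fset.
pose Q : {fset T} := ([fset inl p | p in (S `*` W)%fset] `|`
  [fset inr p | p in (S `*` Z)%fset])%fset.
pose c (t : T) : R := match t with inl p => lam * #|` F p.2.1|%:R | inr _ => s end.
have inl_code x p : (inl p \in code x) = (p \in P x).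
  rewrite inE; apply/orP/idP => [[/imfsetP[q/= qP [->]]//|/imfsetP[]//]|pP].
  by left; apply/imfsetP; exists p.
have inr_code x g y : (inr (g, y) \in code x) = (g \in rest x) && (y == z (act g x)).
  rewrite inE; apply/orP/andP => [[/imfsetP[]//|/imfsetP[h/= hr [-> ->]]//]|[gr /eqP->]].
  by right; apply/imfsetP; exists g.
have c_ge0 t : 0 <= c t by case: t => [p|p] /=; rewrite ?mulr_ge0// ltW.
have suml (A : {fset G * V}) (f : T -> R) :
    \sum_(t <- [fset inl p | p in A]%fset) f t = \sum_(p <- A) f (inl p).
  by rewrite big_imfset//= => ? ? _ _ [].
have sumr (A : {fset G * X}) (f : T -> R) :
    \sum_(t <- [fset inr p | p in A]%fset) f t = \sum_(p <- A) f (inr p).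
  by rewrite big_imfset//= => ? ? _ _ [].
have sumQ : \sum_(t <- Q) expR (- c t) <=
    (\sum_(v <- W) w v + #|` Z|%:R * expR (- s)) * #|` S|%:R.
  apply: le_trans (le_sum_fsetU _ _ (fun t => expR_ge0 _)) _.
  rewrite suml sumr mulrDl lerD//.
    rewrite (sum_fsetM_snd S W (fun v => expR (- (lam * #|` F v.1|%:R)))) mulrC.
    rewrite ler_wpM2r//; apply: ler_sum => v _; by rewrite /w mulNr.
  rewrite (sum_fsetM_snd S Z (fun=> expR (- s))) mulrC ler_wpM2r//.
  by rewrite big_const_seq count_predT iter_addr addr0 mulr_natl.
have sumc x : \sum_(t <- code x) c t <= (lam / (1 - e) + s * rho) * #|` S|%:R.
  apply: le_trans (le_sum_fsetU _ _ c_ge0) _.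
  rewrite suml big_imfset/=; last by move=> ? ? _ _ [].
  have [[_ PS wP] cP] := PP x.
  rewrite mulrDl lerD//.
    rewrite -mulr_sumr -mulrA ler_wpM2l//; first exact: ltW.
    by rewrite ler_pdivlMl ?subr_gt0// (le_trans wP)// ler_nat fsubset_leq_card.
  rewrite big_const_seq count_predT iter_addr addr0 -[leLHS]mulr_natr.
  rewrite -mulrA ler_wpM2l//; apply: le_trans cP.
  by rewrite lerBrDl -natrD ler_nat -(cardfsID (fcup (tile fst F) (P x)) S) (fsetIidPr PS).
have codeQ x : x \in H -> (code x `<=` Q)%fset.
  move=> _; have [[Pin _ _] _] := PP x.
  apply/fsetUSS; apply/fsubsetP => t /imfsetP[p/= pP ->]; apply/imfsetP.
    by exists p => //=; rewrite in_fsetM; have [-> ->] := Pin _ pP.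
  exists (p, z (act p x)) => //=; rewrite in_fsetM/= (zP _).1 andbT.
  by move: pP; rewrite inE => /andP[].
(* Equal codes put [act g x] and [act g y] within [delta] of a common point for every [g] in [F N],
   against separation at [2 * delta]. On a tile, [g = f p.1] and the point is the image under [f] of
   the centre of the ball; elsewhere it is a net point. *)
have code_inj : {in H &, injective code}.
  move=> x y xH yH xy; apply/eqP/negPn/negP => nxy.
  have := sepH _ _ xH yH nxy; apply/negP; rewrite -leNgt.
  apply: dist_on_le => [|g gS]; first by rewrite mulr_ge0// ltW.
  have Pxy : P x = P y by apply/fsetP => p; rewrite -!inl_code xy.
  have near u : mdist u (act g x) < delta -> mdist u (act g y) < delta ->
      mdist (act g x) (act g y) <= 2 * delta.
    move=> ux uy; rewrite (le_trans (metric_triangle _ u _))// metric_sym.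
    by rewrite mulr_natl mulr2n ltW// ltrD.
  have [/fcupP[p pP /imfsetP[f/= fF gE]]|gU] := boolP (g \in fcup (tile fst F) (P x)).
    have [[Px _ _] _] := PP x; have [[Py _ _] _] := PP y.
    have [_ _ Ox] := Px _ pP; rewrite Pxy in pP; have [_ _ Oy] := Py _ pP.
    apply: (near (act f p.2.2)); rewrite gE actM.
      exact: le_lt_trans (mdist_le_dist_on _ _ _ fF) Ox.
    exact: le_lt_trans (mdist_le_dist_on _ _ _ fF) Oy.
  have : inr (g, z (act g x)) \in code y.
    by rewrite -xy inr_code eqxx andbT inE gU.
  rewrite inr_code => /andP[_ /eqP zxy]; apply: (near (z (act g x))); first exact: (zP _).2.
  by rewrite zxy; exact: (zP _).2.
apply: (le_trans (card_codes code_inj codeQ (fun x _ => sumc x))).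
by rewrite ler_expR [leRHS]mulrDl lerD.
Qed.

(** The exponent of [separated_bound] exceeds [lam] by at most [e' / 4] for overlaps of tiles plus
    four errors of at most [h = e' / 8]: the net, the boundaries, the gap left by [M] layers and the
    weights of the covers. The choices are made in the order [e], [s], [eta], [M], [W]. *)
Lemma separated_growth (e' : R) : 0 < e' ->
  \forall N \near \oo, forall H : {fset X},
    delta_separated act (F N) (2 * delta) H ->
    #|` H|%:R <= expR ((lam + e') * #|` F N|%:R).
Proof.
move=> e'0; have [Z netZ] := compact_finite_net X_compact delta_gt0.
pose q := e' / (4 * lam).
have q0 : 0 < q by rewrite divr_gt0// mulr_gt0.
(* Makes [1 / (1 - e) = 1 + q], hence [lam / (1 - e) = lam + e' / 4]. *)
pose e := 1 - (1 + q)^-1.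
have q1 : 0 < 1 + q by lra.
have iq0 : 0 < (1 + q)^-1 by rewrite invr_gt0.
have iq1 : (1 + q)^-1 < 1 by rewrite invf_lt1//; lra.
have e01 : 0 < e < 1 by rewrite /e; lra.
have eE : (1 - e)^-1 = 1 + q by rewrite /e opprB addrC subrK invrK.
have lamq : lam * q = e' / 4 by rewrite /q; field; rewrite gt_eqF.
pose h := e' / 8.
have h0 : 0 < h by rewrite divr_gt0.
pose s := #|` Z|%:R / h.
have s0 : 0 <= s by rewrite divr_ge0// ltW.
(* From [s <= expR s] and [h * s = #|Z|]. *)
have Zs : #|` Z|%:R * expR (- s) <= h.
  rewrite expRN ler_pdivrMr ?expR_gt0//.
  apply: (@le_trans _ _ (h * s)); last first.
    by rewrite ler_wpM2l ?ltW// (lt_le_trans _ (expR_ge1Dx _))// ltrDr.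
  by rewrite /s mulrCA divff ?gt_eqF// mulr1.
have [r /andP[r0 r1] codes] := @layered_codes R G X act F V fst O w F_folner
  F_tempered (fun v => expR_ge0 _) light_covers e e01.
have s10 : 0 < s + 1 by lra.
pose eta := h / ((s + 1) * (1 + (1 + q))).
have eta0 : 0 < eta by rewrite divr_gt0// mulr_gt0//; lra.
have seta : s * (eta * (1 + (1 - e)^-1)) <= h.
  have -> : s * (eta * (1 + (1 - e)^-1)) = h * (s / (s + 1)).
    by rewrite eE /eta; field; rewrite !gt_eqF//; lra.
  by apply: ler_piMr; [exact: ltW|rewrite ltW// ltr_pdivrMr// mul1r ltrDl].
have [M _ hM] : \forall M \near \oo, (1 - r) ^+ M < h / (s + 1).
  have /cvgrPdist_lt/(_ (h / (s + 1))) : (1 - r) ^+ n @[n --> \oo] --> (0 : R).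
    by apply: cvg_expr; rewrite ger0_norm; lra.
  move=> /(_ (divr_gt0 h0 s10)); apply: filterS => n /=.
  by rewrite sub0r normrN; apply: le_lt_trans; exact: ler_norm.
have {hM} := hM M (leqnn _); set u := (1 - r) ^+ M => hM.
have sM : s * u <= h.
  apply: (@le_trans _ _ (s * (h / (s + 1)))); first by rewrite ler_wpM2l// ltW.
  rewrite mulrCA; apply: ler_piMr; first exact: ltW.
  by rewrite ltW// ltr_pdivrMr// mul1r ltrDl.
have M10 : 0 < M%:R + 1 :> R by rewrite ltr_wpDl.
(* [M] covers of weight at most [h / (M + 1)] weigh at most [h] together. No finer tiles lie below
   the first cover, hence the window [fset0]. *)
have [W [wW _]] := codes eta (h / (M%:R + 1)) eta0 (divr_gt0 h0 M10) M fset0.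
apply: filterS => N hN H sepH.
apply: (le_trans (separated_bound e01 s0 netZ hN sepH)).
rewrite ler_expR ler_wpM2r// -/u.
have wWh : \sum_(v <- W) w v <= h.
  apply: (le_trans wW); rewrite mulrCA; apply: ler_piMr; first exact: ltW.
  by rewrite ltW// ltr_pdivrMr// mul1r ltrDl.
have h4 : h = e' / 8 by [].
rewrite mulrDr eE mulrDr mulr1 lamq.
move: seta; rewrite eE; lra.
Qed.

End separated_codes.

(** * Upper limits and stability of mean dimensions *)

Section ereal_limsup.
Variable R : realType.

(** Reduces comparisons of extended reals to real upper bounds, the form taken by the entropy
    estimates below. *)
Lemma lee_real_upper (x y : \bar R) :
  (forall r : R, (y <= r%:E -> x <= r%:E)%E) -> (x <= y)%E.
Proof.
move: y => [y|_|]; [exact|exact: leey|] => h.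
case: x h => [x|/(_ 0%R)|//] h; last by have := h (leNye _).
have : (x%:E <= (x - 1)%R%:E)%E by apply: h; exact: leNye.
by rewrite lee_fin lerBrDr gerDl ler10.
Qed.

Lemma limf_esup_le (T : choiceType) (Y : filteredType T) (f : Y -> \bar R) (D : set_system Y) y :
  (\forall x \near D, (f x <= y)%E) -> (limf_esup f D <= y)%E.
Proof.
move=> fy; apply: le_trans (_ : ereal_sup (f @` [set x | (f x <= y)%E]) <= y)%E.
  by apply: ereal_inf_lbound; exists [set x | (f x <= y)%E].
by apply: ge_ereal_sup => _ [x /= ? <-].
Qed.

Lemma limf_esup_lt (T : choiceType) (Y : filteredType T) (f : Y -> \bar R) (D : set_system Y) y :
  Filter D -> (limf_esup f D < y)%E -> \forall x \near D, (f x < y)%E.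
Proof.
move=> FD /ereal_inf_lt[_ [V DV <-] Vy]; apply: filterS DV => x Vx.
by apply: le_lt_trans Vy; apply: ereal_sup_ubound; exists x.
Qed.

Lemma limf_esup_le_max (T : choiceType) (Y : filteredType T) (f g h : Y -> \bar R)
    (D : set_system Y) :
  Filter D -> (\forall x \near D, (h x <= Order.max (f x) (g x))%E) ->
  (limf_esup h D <= Order.max (limf_esup f D) (limf_esup g D))%E.
Proof.
move=> FD hfg; rewrite leNgt; apply/negP; rewrite gt_max => /andP[].
move=> /ereal_inf_lt[_ [V DV <-] Vh] /ereal_inf_lt[_ [W DW <-] Wh].
have := Order.POrderTheory.lt_irreflexive (limf_esup h D).
rewrite (@le_lt_trans _ _ (Order.max (ereal_sup (f @` V)) (ereal_sup (g @` W))))//.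
  apply: limf_esup_le; near=> x; have xV : V x by near: x.
  have xW : W x by near: x.
  apply: (@le_trans _ _ (Order.max (f x) (g x))); first by near: x.
  rewrite ge_max !le_max; apply/andP; split; apply/orP; [left|right];
    by apply: ereal_sup_ubound; exists x.
by rewrite gt_max Vh Wh.
Unshelve. all: by end_near. Qed.

(** Meant for entropies that are infima of admissible exponents: the larger of two exponents is
    admissible for a union. *)
Lemma ereal_inf_le_max (A B C : set (\bar R)) :
  (forall a b, A a -> B b -> exists2 c, C c & (c <= Order.max a b)%E) ->
  (ereal_inf C <= Order.max (ereal_inf A) (ereal_inf B))%E.
Proof.
move=> ABC; rewrite leNgt; apply/negP; rewrite gt_max => /andP[].
move=> /ereal_inf_lt[a Aa aC] /ereal_inf_lt[b Bb bC].
have [c Cc] := ABC _ _ Aa Bb; apply/negP; rewrite -ltNge.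
apply: (@lt_le_trans _ _ (ereal_inf C)); first by rewrite gt_max aC.
exact: ereal_inf_lbound.
Qed.

Lemma near0_right (P : R -> Prop) :
  (\forall d \near 0^'+, P d) <-> exists2 e : R, 0 < e & forall d, 0 < d < e -> P d.
Proof.
split=> [[e /= e0 he]|[e e0 he]].
  exists e => // d /andP[d0 de]; apply: he => //=.
  by rewrite sub0r normrN gtr0_norm.
near=> d; apply: he; apply/andP; split; near: d; first exact: nbhs_right_gt.
exact: nbhs_right_lt.
Unshelve. all: by end_near. Qed.

End ereal_limsup.

Section mdim_of.
Variables (R : realType) (X : metricType R).
Implicit Types (h : set X -> R -> \bar R) (Z A B : set X).

Let ln_inv_gt0 (d : R) : 0 < d < 1 -> 0 < ln d^-1.
Proof. by move=> /andP[d0 d1]; rewrite ln_gt0// invf_gt1. Qed.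

(** [h1] at [d] is compared with [h2] at [d / c], whose logarithm is larger by the constant [ln c],
    negligible against [ln d^-1] as [d] tends to [0]. *)
Lemma mdim_of_scale h1 h2 Z (c : R) : 1 <= c ->
  (forall d, 0 < d -> (h1 Z (c * d)%R <= h2 Z d)%E) ->
  (mdim_of h1 Z <= mdim_of h2 Z)%E.
Proof.
move=> c1 h12; have c0 : 0 < c by lra.
apply: lee_real_upper => a ha; apply/lee_addgt0Pr => e e0.
have e20 : 0 < e / 2 by rewrite divr_gt0.
have /limf_esup_lt : (mdim_of h2 Z < (a + e / 2)%:E)%E.
  by apply: le_lt_trans ha _; rewrite lte_fin ltrDl.
move=> /near0_right[d1 d10 hd1].
have lnc : 0 <= ln c by rewrite ln_ge0.
(* Once [ln d^-1 >= b], the extra term [(a + e / 2) * ln c] is at most [e / 2 * ln d^-1]. *)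
pose b := `|a + e / 2| * ln c / (e / 2).
have b0 : 0 <= b by rewrite divr_ge0 ?mulr_ge0// ltW.
apply: limf_esup_le; apply/near0_right.
exists (Num.min (Num.min 1 d1) (expR (- b))).
  by rewrite !lt_min d10 expR_gt0 ltr01.
move=> d /andP[d0]; rewrite !lt_min => /andP[/andP[dlt1 dd1] db].
have dc0 : 0 < d / c by rewrite divr_gt0.
have dcd : d / c <= d by rewrite ler_pdivrMr// ler_peMr// ltW.
have ld0 : 0 < ln d^-1 by apply: ln_inv_gt0; rewrite d0.
have ldc0 : 0 < ln (d / c)^-1 by apply: ln_inv_gt0; rewrite dc0 (le_lt_trans dcd).
have lb : b <= ln d^-1.
  by rewrite lnV// lerNr -ler_expR lnK// ltW.
have ldcE : ln (d / c)^-1 = ln d^-1 + ln c.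
  by rewrite invf_div lnM ?posrE ?invr_gt0// addrC.
have : (h2 Z (d / c)%R * ((ln (d / c)%R^-1)^-1)%:E < (a + e / 2)%:E)%E.
  by apply: hd1; rewrite dc0 (le_lt_trans dcd).
rewrite lte_pdivrMr// -EFinM => h2a.
rewrite lee_pdivrMr//; apply: (@le_trans _ _ (h2 Z (d / c))).
  by rewrite -[X in h1 Z X](divfK (lt0r_neq0 c0)) mulrC h12.
apply: (le_trans (ltW h2a)); rewrite -EFinD -EFinM lee_fin ldcE mulrDr.
have : (a + e / 2) * ln c <= e / 2 * ln d^-1.
  apply: (@le_trans _ _ (e / 2 * b)); last by rewrite ler_pM2l.
  rewrite /b mulrCA divff ?gt_eqF// mulr1 ler_wpM2r//; exact: ler_norm.
lra.
Qed.

Lemma mdim_of_mono h A B : (forall d, 0 < d -> (h A d <= h B d)%E) ->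
  (mdim_of h A <= mdim_of h B)%E.
Proof.
(* The case [c = 1], for two functions that ignore their set argument. *)
by move=> hAB; apply: (@mdim_of_scale (fun _ => h A) (fun _ => h B) A 1) => // d d0;
  rewrite mul1r; exact: hAB.
Qed.

Lemma mdim_ofU h A B :
  (forall d, 0 < d -> (h (A `|` B) d <= Order.max (h A d) (h B d))%E) ->
  (mdim_of h (A `|` B) <= Order.max (mdim_of h A) (mdim_of h B))%E.
Proof.
move=> hAB; apply: limf_esup_le_max; apply/near0_right; exists 1 => // d d01.
have [d0 _] := andP d01; have := hAB _ d0; rewrite !le_max.
have l0 : (0 <= ((ln d^-1)^-1)%:E)%E by rewrite lee_fin invr_ge0 ltW// ln_inv_gt0.
by move=> /orP[] h1; apply/orP; [left|right]; exact: lee_wpmul2r.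
Qed.

(* Finite stability passes the value on [X] to a member of every finite cover
   by closed neighbourhoods, so by compactness some point carries all of it. *)
Lemma local_of_max (m : set X -> \bar R) :
  compact [set: X] -> [set: X] !=set0 ->
  (forall A B, A `<=` B -> (m A <= m B)%E) ->
  (forall A B, (m (A `|` B) <= Order.max (m A) (m B))%E) ->
  is_max_of (local_of m) (m [set: X]).
Proof.
move=> cX [x0 _] m_mono mU.
have loc_le x : (local_of m x <= m [set: X])%E.
  by apply: ereal_inf_lbound; exists setT => //; split; [exact: closedT|exact: filterT].
split; last by move=> _ [x _ <-].
apply: contrapT => no_max.
have loc_lt x : (local_of m x < m [set: X])%E.
  rewrite lt_neqAle loc_le andbT; apply/eqP => lx.
  by apply: no_max; exists x.
have /choice[K KP] : forall x : X, exists K : set X,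
    [/\ closed K, nbhs x K & (m K < m [set: X])%E].
  by move=> x; have /ereal_inf_lt[_ [K [cK nK] <-] mK] := loc_lt x; exists K.
have [|x _|D _ DX] := compact_open_cover cX (D := setT) (f := fun x => (K x)^°).
- by move=> x _; exact: open_interior.
- by exists x => //; have [_ ? _] := KP x.
- suff mD (E : {fset X}) : (m (\bigcup_(x in [set` E]) K x) < m [set: X])%E.
    have := mD D; apply/negP; rewrite -leNgt; apply: m_mono => x xT.
    by have [y yD /interior_subset Ky] := DX x xT; exists y.
  elim/fset1U_rect: E => [|y E yE IH].
    (* The empty union is bounded through [K x0]; a point of [X] is used here. *)
    by have [_ _] := KP x0; apply: le_lt_trans; apply: m_mono => x [].
  apply: le_lt_trans (_ : _ <= Order.max (m (K y)) (m (\bigcup_(x in [set` E]) K x)))%E _.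
    apply: le_trans (mU _ _); apply: m_mono => x [z /= /fset1UP[->|zE] Kz].
      by left.
    by right; exists z.
  by rewrite gt_max IH andbT; have [] := KP y.
Qed.

End mdim_of.

(** * The three entropies *)

Section htop.
Variables (R : realType) (G : groupType) (X : metricType R).
Variables (act : G -> X -> X) (F : nat -> {fset G}).
Hypothesis F0 : forall n, F n != fset0.
Implicit Types (K A B : set X) (H : {fset X}) (E : {fset G}).

Let F_gt0 n : 0 < #|` F n|%:R :> R.
Proof. by rewrite ltr0n cardfs_gt0. Qed.

Lemma card_le_sep_number E K delta H : [set` H] `<=` K ->
  delta_separated act E delta H -> ((#|` H|%:R)%:E <= sep_number act E K delta)%E.
Proof. by move=> HK sH; apply: ereal_sup_ubound; exists H. Qed.

Lemma sep_number_le E K delta (y : R) :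
  (forall H, [set` H] `<=` K -> delta_separated act E delta H -> #|` H|%:R <= y) ->
  (sep_number act E K delta <= y%:E)%E.
Proof.
by move=> h; apply: ge_ereal_sup => _ [H [HK sH] <-]; rewrite lee_fin h.
Qed.

Lemma sep_number_ge0 E K delta : (0 <= sep_number act E K delta)%E.
Proof.
by apply: le_trans (card_le_sep_number (H := fset0) _ _) => [//|x|x y]; rewrite ?inE.
Qed.

(** With [htop_growth] as converse, this trades the upper limit of normalized logarithms for an
    eventual exponential bound on finite separated sets. *)
Lemma htop_le K delta (m : R) :
  (forall e : R, 0 < e -> \forall n \near \oo, forall H, [set` H] `<=` K ->
    delta_separated act (F n) delta H -> #|` H|%:R <= expR ((m + e) * #|` F n|%:R)) ->
  (htop act F K delta <= m%:E)%E.
Proof.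
move=> h; apply/lee_addgt0Pr => e e0; apply: limf_esup_le.
apply: filterS (h _ e0) => n hn.
rewrite muleC lee_pdivrMr// -EFinD -EFinM.
rewrite -(expRK ((m + e) * _)) -lne_EFin ?expR_gt0// lee_lne.
- exact: sep_number_le.
- by rewrite in_itv/= sep_number_ge0 leey.
- by rewrite in_itv/= lee_fin expR_ge0 leey.
Qed.

Lemma htop_growth K delta (m e : R) : (htop act F K delta <= m%:E)%E -> 0 < e ->
  \forall n \near \oo, forall H, [set` H] `<=` K ->
    delta_separated act (F n) delta H -> #|` H|%:R <= expR ((m + e) * #|` F n|%:R).
Proof.
move=> hm e0; have /limf_esup_lt : (htop act F K delta < (m + e)%:E)%E.
  by apply: le_lt_trans hm _; rewrite lte_fin ltrDl.
apply: filterS => n + H HK sH; rewrite muleC lte_pdivrMr// -EFinM => hn.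
have [H0|H0] := posnP #|` H|; first by rewrite H0 expR_ge0.
have H1 : 0 < #|` H|%:R :> R by rewrite ltr0n.
rewrite -ler_ln ?posrE ?expR_gt0// expRK -lee_fin; apply: le_trans (ltW hn).
rewrite -lne_EFin// lee_lne.
- exact: card_le_sep_number.
- by rewrite in_itv/= lee_fin ler0n leey.
- by rewrite in_itv/= sep_number_ge0 leey.
Qed.

Lemma htop_mono A B delta : A `<=` B ->
  (htop act F A delta <= htop act F B delta)%E.
Proof.
move=> AB; apply: lee_real_upper => r hr; apply: htop_le => e e0.
apply: filterS (htop_growth hr e0) => n hn H HA; apply: hn.
exact: subset_trans HA AB.
Qed.

(** A separated set splits into its parts in [A] and in [B]; the factor [2] is absorbed by
    [expR (e / 2 * #|F n|)] since [#|F n|] tends to infinity. *)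
Lemma htopU A B delta : (#|` F n|%:R : R) @[n --> \oo] --> +oo ->
  (htop act F (A `|` B) delta <=
    Order.max (htop act F A delta) (htop act F B delta))%E.
Proof.
move=> Foo; apply: lee_real_upper => r; rewrite ge_max => /andP[hA hB].
apply: htop_le => e e0; have e20 : 0 < e / 2 by rewrite divr_gt0.
have /cvgryPge/(_ (ln 2 / (e / 2))) := Foo.
have := htop_growth hB e20; have := htop_growth hA e20.
apply: filterS3 => n hnA hnB Fn H HAB sH.
pose HA := [fset x in H | x \in A]%fset; pose HB := [fset x in H | x \in B]%fset.
have subsep (H' : {fset X}) : (H' `<=` H)%fset -> delta_separated act (F n) delta H'.
  by move=> /fsubsetP HH x y /HH xH /HH yH; exact: sH.
have cA : #|` HA|%:R <= expR ((r + e / 2) * #|` F n|%:R).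
  apply: hnA; first by move=> x /=; rewrite !inE => /andP[_ /set_mem].
  by apply: subsep; apply/fsubsetP => x; rewrite !inE => /andP[].
have cB : #|` HB|%:R <= expR ((r + e / 2) * #|` F n|%:R).
  apply: hnB; first by move=> x /=; rewrite !inE => /andP[_ /set_mem].
  by apply: subsep; apply/fsubsetP => x; rewrite !inE => /andP[].
have : #|` H|%:R <= #|` HA|%:R + #|` HB|%:R :> R.
  rewrite -natrD ler_nat (leq_trans _ (leq_card_fsetU _ _).1)//.
  apply/fsubset_leq_card/fsubsetP => x xH; rewrite !inE xH/=.
  by have [Ax|Bx] := HAB x xH; apply/orP; [left|right]; exact/mem_set.
move=> /le_trans; apply; apply: le_trans (lerD cA cB) _.
have twice (y : R) : expR y + expR y = expR (ln 2 + y).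
  by rewrite expRD lnK ?posrE// mulr_natl mulr2n.
rewrite twice ler_expR; move: Fn; rewrite ler_pdivrMr//; lra.
Qed.

End htop.

(** * Caratheodory-type constructions by packings and by covers *)

Section caratheodory.
Variables (R : realType) (G : groupType) (X : metricType R).
Variables (act : G -> X -> X) (F : nat -> {fset G}).
Variable x0 : X.
Implicit Types (Z A B : set X) (lam eps delta : R) (I : set nat).

Lemma family_sum_ge0 lam I m : (0 <= family_sum F lam I m)%E.
Proof. by apply: esum_ge0 => i _; rewrite lee_fin expR_ge0. Qed.

Lemma family_sum_anti lam lam' I m : lam <= lam' ->
  (family_sum F lam' I m <= family_sum F lam I m)%E.
Proof.
by move=> ll'; apply: le_esum => i _; rewrite lee_fin ler_expR ler_wpM2r// lerN2.
Qed.

Lemma bowen_pre_ge0 lam eps delta Z : (0 <= bowen_pre act F lam eps delta Z)%E.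
Proof. by apply: le_ereal_inf_tmp => _ [I [c [m [_ ->]]]]; exact: family_sum_ge0. Qed.

Lemma bowen_pre_eps lam eps eps' delta Z : 0 < eps <= eps' ->
  (bowen_pre act F lam eps' delta Z <= bowen_pre act F lam eps delta Z)%E.
Proof.
move=> /andP[e0 ee']; apply: ereal_inf_le_tmp => _ [I [c [m [[sz cov] ->]]]].
exists I, c, m; split=> //; split=> // i /sz; apply: le_trans.
by rewrite lef_pV2// posrE (lt_le_trans e0).
Qed.

Lemma bowen_pre_anti lam lam' eps delta Z : lam <= lam' ->
  (bowen_pre act F lam' eps delta Z <= bowen_pre act F lam eps delta Z)%E.
Proof.
move=> ll'; apply: le_ereal_inf_tmp => _ [I [c [m [cov ->]]]].
apply: le_trans (family_sum_anti I m ll').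
by apply: ereal_inf_lbound; exists I, c, m.
Qed.

Lemma bowen_pre_mono lam eps delta A B : A `<=` B ->
  (bowen_pre act F lam eps delta A <= bowen_pre act F lam eps delta B)%E.
Proof.
move=> AB; apply: ereal_inf_le_tmp => _ [I [c [m [[sz cov] ->]]]].
by exists I, c, m; split=> //; split=> //; exact: subset_trans AB cov.
Qed.

(** A smaller [eps] admits fewer covers, so the infimum grows and the limit is a supremum. *)
Lemma bowen_limE lam delta Z : bowen_lim act F lam delta Z =
  ereal_sup [set bowen_pre act F lam eps delta Z | eps in [set eps | 0 < eps]].
Proof.
have -> : [set eps | 0 < eps] = [set` Interval (BRight (0 : R)) +oo%O].
  by apply/seteqP; split=> e /=; rewrite in_itv/= andbT.
apply: cvg_lim => //; apply: nonincreasing_at_right_cvge => // e e'.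
rewrite !in_itv/= !andbT => e0 e'0 ee'; apply: bowen_pre_eps.
by rewrite e0.
Qed.

Lemma bowen_pre_le_lim lam eps delta Z : 0 < eps ->
  (bowen_pre act F lam eps delta Z <= bowen_lim act F lam delta Z)%E.
Proof. by move=> e0; rewrite bowen_limE; apply: ereal_sup_ubound; exists eps. Qed.

Lemma bowen_lim_le lam delta Z y :
  (forall eps, 0 < eps -> (bowen_pre act F lam eps delta Z <= y)%E) ->
  (bowen_lim act F lam delta Z <= y)%E.
Proof. by move=> h; rewrite bowen_limE; apply: ge_ereal_sup => _ [e /= e0 <-]; exact: h. Qed.

Lemma bowen_lim_ge0 lam delta Z : (0 <= bowen_lim act F lam delta Z)%E.
Proof. exact: le_trans (bowen_pre_ge0 _ _ _ _) (bowen_pre_le_lim _ _ _ ltr01). Qed.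

Lemma packing_pre_ge0 lam eps delta Z : (0 <= packing_pre act F lam eps delta Z)%E.
Proof.
apply: ereal_sup_ubound; exists set0, (fun=> x0), (fun=> 0%N); split.
  by split=> // i j [].
by rewrite /family_sum esum_set0.
Qed.

Lemma packing_pre_eps lam eps eps' delta Z : 0 < eps <= eps' ->
  (packing_pre act F lam eps delta Z <= packing_pre act F lam eps' delta Z)%E.
Proof.
move=> /andP[e0 ee']; apply: ereal_sup_le => _ [I [c [m [[cZ sz tr] ->]]]].
exists I, c, m; split=> //; split=> // i /sz; apply: le_trans.
by rewrite lef_pV2// posrE (lt_le_trans e0).
Qed.

Lemma packing_pre_anti lam lam' eps delta Z : lam <= lam' ->
  (packing_pre act F lam' eps delta Z <= packing_pre act F lam eps delta Z)%E.
Proof.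
move=> ll'; apply: ge_ereal_sup => _ [I [c [m [pk ->]]]].
apply: le_trans (family_sum_anti I m ll') _.
by apply: ereal_sup_ubound; exists I, c, m.
Qed.

(** A smaller [eps] admits fewer packings, so here the limit is an infimum. *)
Lemma packing_limE lam delta Z : packing_lim act F lam delta Z =
  ereal_inf [set packing_pre act F lam eps delta Z | eps in [set eps | 0 < eps]].
Proof.
have -> : [set eps | 0 < eps] = [set` Interval (BRight (0 : R)) +oo%O].
  by apply/seteqP; split=> e /=; rewrite in_itv/= andbT.
apply: cvg_lim => //; apply: nondecreasing_at_right_cvge => // e e'.
rewrite !in_itv/= !andbT => e0 e'0 ee'; apply: packing_pre_eps.
by rewrite e0.
Qed.

Lemma packing_lim_le_pre lam eps delta Z : 0 < eps ->
  (packing_lim act F lam delta Z <= packing_pre act F lam eps delta Z)%E.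
Proof. by move=> e0; rewrite packing_limE; apply: ereal_inf_lbound; exists eps. Qed.

Lemma le_packing_lim lam delta Z y :
  (forall eps, 0 < eps -> (y <= packing_pre act F lam eps delta Z)%E) ->
  (y <= packing_lim act F lam delta Z)%E.
Proof.
by move=> h; rewrite packing_limE; apply: le_ereal_inf_tmp => _ [e /= e0 <-]; exact: h.
Qed.

Lemma packing_lim_ge0 lam delta Z : (0 <= packing_lim act F lam delta Z)%E.
Proof. by apply: le_packing_lim => e _; exact: packing_pre_ge0. Qed.

Lemma packing_lim_anti lam lam' delta Z : lam <= lam' ->
  (packing_lim act F lam' delta Z <= packing_lim act F lam delta Z)%E.
Proof.
move=> ll'; apply: le_packing_lim => e e0.
exact: le_trans (packing_lim_le_pre _ _ _ e0) (packing_pre_anti _ _ _ ll').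
Qed.

Lemma packing_measure_ge0 lam delta Z : (0 <= packing_measure act F lam delta Z)%E.
Proof.
apply: le_ereal_inf_tmp => _ [Zs _ <-]; apply: nneseries_ge0 => i _ _.
exact: packing_lim_ge0.
Qed.

Lemma packing_measure_anti lam lam' delta Z : lam <= lam' ->
  (packing_measure act F lam' delta Z <= packing_measure act F lam delta Z)%E.
Proof.
move=> ll'; apply: le_ereal_inf_tmp => _ [Zs ZZs <-].
apply: (@le_trans _ _ (\sum_(0 <= i <oo) packing_lim act F lam' delta (Zs i))%E).
  by apply: ereal_inf_lbound; exists Zs.
apply: lee_nneseries => [i _ _|i _]; first exact: packing_lim_ge0.
exact: packing_lim_anti.
Qed.

Lemma packing_measure_mono lam delta A B : A `<=` B ->
  (packing_measure act F lam delta A <= packing_measure act F lam delta B)%E.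
Proof.
move=> AB; apply: ereal_inf_le_tmp => _ [Zs BZs <-]; exists Zs => //.
exact: subset_trans AB BZs.
Qed.

(** A packing is split according to whether its centres lie in [A]; subfamilies of a disjoint family
    stay disjoint. *)
Lemma packing_preU lam eps delta A B :
  (packing_pre act F lam eps delta (A `|` B) <=
   packing_pre act F lam eps delta A + packing_pre act F lam eps delta B)%E.
Proof.
apply: ge_ereal_sup => _ [I [c [m [[cAB sz tr] ->]]]].
rewrite /family_sum (esumID (c @^-1` A)); last by move=> i _; rewrite lee_fin expR_ge0.
apply: leeD; apply: ereal_sup_ubound.
  exists (I `&` c @^-1` A), c, m; split=> //; split=> [i []//|i [/sz]//|].
  by apply: sub_trivIset tr => i [].
exists (I `&` ~` (c @^-1` A)), c, m; split=> //; split=> [i [/cAB[]//]|i [/sz]//|].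
by apply: sub_trivIset tr => i [].
Qed.

Lemma packing_limU lam delta A B :
  (packing_lim act F lam delta (A `|` B) <=
   packing_lim act F lam delta A + packing_lim act F lam delta B)%E.
Proof.
have A0 := packing_lim_ge0 lam delta A; have B0 := packing_lim_ge0 lam delta B.
have [Aoo|Afin] := eqVneq (packing_lim act F lam delta A) +oo%E.
  by rewrite Aoo addye ?leey// gt_eqF// (lt_le_trans _ B0).
have [Boo|Bfin] := eqVneq (packing_lim act F lam delta B) +oo%E.
  by rewrite Boo addey ?leey// gt_eqF// (lt_le_trans _ A0).
apply/lee_addgt0Pr => t t0; have t20 : 0 < t / 2 by rewrite divr_gt0.
have : packing_lim act F lam delta A \is a fin_num by rewrite ge0_fin_numE// ltey.
rewrite packing_limE => /(lb_ereal_inf_adherent t20)[_ [e1 /= e10 <-]].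
rewrite -packing_limE => e1A.
have : packing_lim act F lam delta B \is a fin_num by rewrite ge0_fin_numE// ltey.
rewrite packing_limE => /(lb_ereal_inf_adherent t20)[_ [e2 /= e20 <-]].
rewrite -packing_limE => e2B.
have m0 : 0 < Num.min e1 e2 by rewrite lt_min e10.
apply: (le_trans (packing_lim_le_pre lam delta _ m0)).
apply: (le_trans (packing_preU _ _ _ _ _)).
rewrite [t](splitr t) EFinD addeACA; apply: leeD.
  by apply: le_trans (ltW e1A); apply: packing_pre_eps; rewrite m0 ge_min lexx.
by apply: le_trans (ltW e2B); apply: packing_pre_eps; rewrite m0 ge_min lexx orbT.
Qed.

(** Countable covers of [A] and of [B] with small sums are united term by term, and [packing_limU]
    is summed. *)
Lemma packing_measureU0 lam delta A B :
  packing_measure act F lam delta A = 0%E -> packing_measure act F lam delta B = 0%E ->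
  packing_measure act F lam delta (A `|` B) = 0%E.
Proof.
move=> A0 B0; apply/eqP; rewrite eq_le packing_measure_ge0 andbT.
apply/lee_addgt0Pr => t t0; rewrite add0e.
have t20 : 0 < t / 2 by rewrite divr_gt0.
have : packing_measure act F lam delta A \is a fin_num by rewrite A0.
move=> /(lb_ereal_inf_adherent t20)[_ [As AAs <-]].
rewrite -/(packing_measure _ _ _ _ _) A0 add0e => sA.
have : packing_measure act F lam delta B \is a fin_num by rewrite B0.
move=> /(lb_ereal_inf_adherent t20)[_ [Bs BBs <-]].
rewrite -/(packing_measure _ _ _ _ _) B0 add0e => sB.
apply: (@le_trans _ _ (\sum_(0 <= i <oo) packing_lim act F lam delta (As i `|` Bs i))%E).
  apply: ereal_inf_lbound; exists (fun i => As i `|` Bs i) => //.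
  by move=> x [/AAs[i _ Ai]|/BBs[i _ Bi]]; exists i => //; [left|right].
apply: (@le_trans _ _ (\sum_(0 <= i <oo)
    (packing_lim act F lam delta (As i) + packing_lim act F lam delta (Bs i)))%E).
  by apply: lee_nneseries => [i _ _|i _]; [exact: packing_lim_ge0|exact: packing_limU].
rewrite nneseriesD => [|i _ _|i _ _]; [|exact: packing_lim_ge0..].
by rewrite [t](splitr t) EFinD; apply: leeD; exact: ltW.
Qed.

Lemma htop_packing_mono A B delta : A `<=` B ->
  (htop_packing act F A delta <= htop_packing act F B delta)%E.
Proof.
move=> AB; apply: ereal_inf_le_tmp => _ [l [l0 lB] <-]; exists l => //; split=> //.
apply/eqP; rewrite eq_le packing_measure_ge0 andbT -lB.
exact: packing_measure_mono.
Qed.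

Lemma htop_packingU A B delta : (htop_packing act F (A `|` B) delta <=
  Order.max (htop_packing act F A delta) (htop_packing act F B delta))%E.
Proof.
apply: ereal_inf_le_max => _ _ [a [a0 aA] <-] [b [b0 bB] <-].
exists (Num.max a b)%:E; last by rewrite EFin_max lexx.
exists (Num.max a b); [split|by []]; first by rewrite lt_max a0.
apply: packing_measureU0; apply/eqP; rewrite eq_le packing_measure_ge0 andbT.
  by rewrite -aA packing_measure_anti// le_max lexx.
by rewrite -bB packing_measure_anti// le_max lexx orbT.
Qed.

(** Nearly optimal families for the [Zs i], with errors [t / 2 ^ (i + 1)], are merged into one;
    pairs of indices become naturals through [choice.pickle]. *)
Lemma bowen_pre_bigcup lam eps delta (Zs : nat -> set X) :
  (bowen_pre act F lam eps delta (\bigcup_i Zs i) <=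
   \sum_(0 <= i <oo) bowen_pre act F lam eps delta (Zs i))%E.
Proof.
have ge0 i : (0 <= bowen_pre act F lam eps delta (Zs i))%E by exact: bowen_pre_ge0.
have [[i /eqP Zoo]|fin] := pselect
    (exists i, bowen_pre act F lam eps delta (Zs i) == +oo%E).
  by rewrite (@nneseries_pinfty _ _ _ i)// leey.
apply/lee_addgt0Pr => t t0.
apply: le_trans (epsilon_trick xpredT ge0 (ltW t0)).
have /choice[K KP] : forall i, exists K : set nat * (nat -> X) * (nat -> nat),
    covering act F delta eps (Zs i) K.1.1 K.1.2 K.2 /\
    (family_sum F lam K.1.1 K.2 <=
      bowen_pre act F lam eps delta (Zs i) + (t / (2 ^ i.+1)%:R)%:E)%E.
  move=> i; have fini : bowen_pre act F lam eps delta (Zs i) \is a fin_num.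
    by rewrite ge0_fin_numE// ltey; apply/negP => Zoo; apply: fin; exists i.
  have ti : 0 < t / (2 ^ i.+1)%:R by rewrite divr_gt0// ltr0n expn_gt0.
  have [_ [I [c [m [cov ->]]]] /ltW le] := lb_ereal_inf_adherent ti fini.
  by exists (I, c, m).
pose J : set (nat * nat) := [set p | (K p.1).1.1 p.2].
(* The default pair matters only for naturals that encode no pair; none of these is in the merged
   index set. *)
pose dec (n : nat) : nat * nat := odflt (0, 0)%N (choice.unpickle n).
have decK p : dec (choice.pickle p) = p by rewrite /dec choice.pickleK.
pose c n := (K (dec n).1).1.2 (dec n).2.
pose m n := (K (dec n).1).2 (dec n).2.
apply: (@le_trans _ _ (family_sum F lam (choice.pickle @` J) m)).
  apply: ereal_inf_lbound; exists (choice.pickle @` J), c, m; split=> //; split.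
    move=> _ [[i j] Kij <-]; rewrite /m decK; have [[+ _] _] := KP i.
    exact.
  move=> x [i _ Zix]; have [[_ +] _] := KP i => /(_ x Zix)[j Kij xj].
  by exists (choice.pickle (i, j)); [exists (i, j)|rewrite /m /c decK].
rewrite /family_sum esum_image; last first.
  by move=> p q _ _ pq; rewrite -(decK p) pq decK.
under eq_esum => p _ do rewrite /m decK.
rewrite (_ : J = [set: nat] `*`` (fun i => (K i).1.1)); last first.
  by apply/seteqP; split=> [[i j] /= ?|[i j] [_ ?]//]; split.
rewrite -(@esum_esum _ _ _ setT (fun i => (K i).1.1)
  (fun i j => (expR (- lam * #|` F ((K i).2 j)|%:R))%:E)); last first.
  by move=> i j _ _; rewrite lee_fin expR_ge0.
rewrite -nneseries_esumT; last by move=> i; exact: family_sum_ge0.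
apply: lee_nneseries => [i _ _|i _]; first exact: family_sum_ge0.
by have [] := KP i.
Qed.

Lemma bowen_lim_bigcup lam delta Z (Zs : nat -> set X) : Z `<=` \bigcup_i Zs i ->
  (bowen_lim act F lam delta Z <= \sum_(0 <= i <oo) bowen_lim act F lam delta (Zs i))%E.
Proof.
move=> ZZs; apply: bowen_lim_le => e e0.
apply: (le_trans (bowen_pre_mono _ _ _ ZZs)).
apply: (le_trans (bowen_pre_bigcup _ _ _ _)).
apply: lee_nneseries => [i _ _|i _]; first exact: bowen_pre_ge0.
exact: bowen_pre_le_lim.
Qed.

Lemma bowen_lim_anti lam lam' delta Z : lam <= lam' ->
  (bowen_lim act F lam' delta Z <= bowen_lim act F lam delta Z)%E.
Proof.
move=> ll'; apply: bowen_lim_le => e e0.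
exact: le_trans (bowen_pre_anti _ _ _ ll') (bowen_pre_le_lim _ _ _ e0).
Qed.

Lemma bowen_lim_mono lam delta A B : A `<=` B ->
  (bowen_lim act F lam delta A <= bowen_lim act F lam delta B)%E.
Proof.
move=> AB; apply: bowen_lim_le => e e0.
exact: le_trans (bowen_pre_mono _ _ _ AB) (bowen_pre_le_lim _ _ _ e0).
Qed.

Lemma htop_bowen_mono A B delta : A `<=` B ->
  (htop_bowen act F A delta <= htop_bowen act F B delta)%E.
Proof.
move=> AB; apply: ereal_inf_le_tmp => _ [l [l0 lB] <-]; exists l => //; split=> //.
by apply/eqP; rewrite eq_le bowen_lim_ge0 andbT -lB bowen_lim_mono.
Qed.

Lemma bowen_lim0 lam delta : bowen_lim act F lam delta set0 = 0%E.
Proof.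
apply/eqP; rewrite eq_le bowen_lim_ge0 andbT; apply: bowen_lim_le => e e0.
apply: ereal_inf_lbound; exists set0, (fun=> x0), (fun=> 0%N).
by rewrite /family_sum esum_set0; split=> //; split.
Qed.

Lemma htop_bowenU A B delta : (htop_bowen act F (A `|` B) delta <=
  Order.max (htop_bowen act F A delta) (htop_bowen act F B delta))%E.
Proof.
apply: ereal_inf_le_max => _ _ [a [a0 aA] <-] [b [b0 bB] <-].
exists (Num.max a b)%:E; last by rewrite EFin_max lexx.
exists (Num.max a b); [split|by []]; first by rewrite lt_max a0.
have A0 : bowen_lim act F (Num.max a b) delta A = 0%E.
  apply/eqP; rewrite eq_le bowen_lim_ge0 andbT.
  by rewrite -aA bowen_lim_anti// le_max lexx.
have B0 : bowen_lim act F (Num.max a b) delta B = 0%E.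
  apply/eqP; rewrite eq_le bowen_lim_ge0 andbT.
  by rewrite -bB bowen_lim_anti// le_max lexx orbT.
apply/eqP; rewrite eq_le bowen_lim_ge0 andbT -bigcup2E.
apply: le_trans (bowen_lim_bigcup _ _ (@subset_refl _ _)) _.
rewrite eseries0; first exact: lexx.
by move=> [|[|i]] _ _; [exact: A0|exact: B0|exact: bowen_lim0].
Qed.

End caratheodory.

(** * Comparison of the three entropies *)

Section comparisons.
Variables (R : realType) (G : groupType) (X : metricType R).
Variables (act : G -> X -> X) (F : nat -> {fset G}).
Variable x0 : X.
Hypothesis X_compact : compact [set: X].
Hypothesis actM : forall g h x, act (g * h)%g x = act g (act h x).
Hypothesis act_continuous : forall g, continuous (act g).
Hypothesis F_folner : folner R F.
Hypothesis F_tempered : tempered R F.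
Hypothesis F_growth : (#|` F n|%:R / ln (n.+1%:R : R)) @[n --> \oo] --> +oo.
Implicit Types (Z : set X) (lam eps delta : R) (I : set nat).

Lemma growth_ge (b : R) : \forall n \near \oo, b * ln n.+1%:R <= #|` F n|%:R.
Proof.
(* At [n = 0] the divisor [ln 1] vanishes, hence [n >= 1]. *)
have /cvgryPge/(_ b) := F_growth; apply: filterS2 (nbhs_infty_ge 1) => n n1.
by rewrite ler_pdivlMr// ln_gt0// ltr1n ltnS.
Qed.

Lemma card_folner_infty : (#|` F n|%:R : R) @[n --> \oo] --> +oo.
Proof.
apply/cvgryPge => b; have := growth_ge (`|b| / ln 2).
apply: filterS2 (nbhs_infty_ge 1) => n n1; apply: le_trans.
apply: (le_trans (ler_norm _)); have l2 : 0 < ln (2 : R) by rewrite ln_gt0// ltr1n.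
rewrite -mulrA ler_peMr// ler_pdivlMl// mulr1 ler_ln ?posrE ?ltr0n//.
by rewrite ler_nat.
Qed.

(** Families are constrained by [#|F n|], whereas asymptotic bounds hold for large [n]; a threshold
    above the sizes of the first [N] sets converts one into the other. *)
Lemma large_index (N : nat) : exists2 e : R, 0 < e &
  forall n, e^-1 <= #|` F n|%:R -> (N <= n)%N.
Proof.
pose b : R := (\sum_(k < N) #|` F k|).+1%:R.
have b0 : 0 < b by rewrite ltr0n.
exists b^-1; rewrite ?invr_gt0// invrK => n; apply: contraTT; rewrite -ltnNge => nN.
by rewrite -ltNge ltr_nat ltnS (bigD1 (Ordinal nN))//= leq_addr.
Qed.

Lemma open_ball_on_open (E : {fset G}) delta x : 0 < delta ->
  open (open_ball_on act E delta x).
Proof.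
move=> d0; rewrite openE => y /= xy.
have : \forall z \near y, (\bigcap_(g in [set` E])
    [set z | mdist (act g x) (act g z) < delta]) z.
  apply: filter_bigI => g gE.
  have r0 : 0 < delta - mdist (act g x) (act g y).
    by rewrite subr_gt0; exact: le_lt_trans (mdist_le_dist_on _ _ _ gE) xy.
  have : \forall z \near y, ball (act g y) (delta - mdist (act g x) (act g y)) (act g z).
    exact: act_continuous (nbhsx_ballx (act g y) _ r0).
  apply: filterS => z /=.
  rewrite ballEmdist/= ltrBrDl => yz.
  exact: le_lt_trans (metric_triangle _ (act g y) _) yz.
apply: filterS => z hz; rewrite /open_ball_on/= /dist_on big_seq.
by elim/big_ind: _ => // a b a0 b0; rewrite gt_max a0.
Qed.

Lemma le_sum_imfset (T S : choiceType) (A : {fset T}) (f : T -> S) (a : S -> R) :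
  (forall s, 0 <= a s) ->
  \sum_(s <- [fset f t | t in A]%fset) a s <= \sum_(t <- A) a (f t).
Proof.
move=> a0; elim/fset1U_rect: A => [|t A tA IH]; first by rewrite imfset0 !big_seq_fset0.
rewrite imfsetU1 [leRHS]big_fsetU1//= (le_trans (le_sum_fsetU _ _ a0))//.
by rewrite big_seq_fset1 lerD2l.
Qed.

(** A vanishing Bowen measure gives a countable cover of small weight with large indices; its balls
    are open, so compactness leaves finitely many. *)
Lemma light_covers lam delta : 0 < delta ->
  bowen_lim act F lam delta [set: X] = 0%E ->
  forall (L : nat) (eta : R), 0 < eta -> exists2 W : {fset nat * X},
    (forall v, v \in W -> (L <= v.1)%N) &
    \sum_(v <- W) expR (- lam * #|` F v.1|%:R) <= eta /\
    forall x, exists2 v, v \in W & open_ball_on act (F v.1) delta v.2 x.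
Proof.
move=> d0 lim0 L eta eta0; have [e e0 eL] := large_index L.
have : (bowen_pre act F lam e delta [set: X] < eta%:E)%E.
  by rewrite (le_lt_trans (bowen_pre_le_lim _ _ _ _ _ e0))// lim0 lte_fin.
move=> /ereal_inf_lt[_ [I [c [m [[sz cov] ->]]]] small].
have [i Ii|x xT|D DI DX] := compact_open_cover X_compact (D := I)
    (f := fun i => open_ball_on act (F (m i)) delta (c i)).
- exact: open_ball_on_open.
- exact: cov.
have DI' i : i \in D -> I i by move=> /DI/set_mem.
exists [fset (m i, c i) | i in D]%fset.
  by move=> _ /imfsetP[i /= /DI' Ii ->]; exact: eL (sz _ Ii).
split; last first.
  move=> x; have [i iD xi] := DX x Logic.I.
  by exists (m i, c i) => //; apply/imfsetP; exists i.
apply: le_trans (le_sum_imfset _ _ (fun v => expR_ge0 _)) _.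
rewrite -lee_fin -sumEFin; apply: le_trans (ltW small).
apply: esum_ge; exists [set` D]; first by split.
by rewrite fsbig_finite//= set_fsetK.
Qed.

Lemma htop_le_bowen delta : 0 < delta ->
  (htop act F [set: X] (2 * delta)%R <= htop_bowen act F [set: X] delta)%E.
Proof.
move=> d0; apply: le_ereal_inf_tmp => _ [lam [lam0 lim0] <-].
apply: htop_le => [|e e0]; first exact: folner_neq0 F_folner.
have := separated_growth X_compact actM F_folner F_tempered lam0 d0
  (light_covers d0 lim0) e0.
by apply: filterS => n h H _; exact: h.
Qed.

(* A maximal disjoint packing by [n]-balls of radius [delta] becomes a cover
   when the radius is tripled. *)
Lemma bowen_pre_le_packing lam eps delta Z : 0 < delta -> 0 < eps ->
  (bowen_pre act F lam eps (3 * delta)%R Z <= packing_pre act F lam eps delta Z)%E.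
Proof.
move=> d0 e0; have /cvgryPge/(_ eps^-1)[n _ /(_ n (leqnn n)) /= nF] := card_folner_infty.
set E := F n in nF *.
pose ok (H : {fset X}) := [set` H] `<=` Z /\ forall x y, x \in H -> y \in H ->
  (closed_ball_on act E delta x `&` closed_ball_on act E delta y) !=set0 -> x = y.
have [x _|x _|D _ DX] := compact_open_cover X_compact (D := setT)
    (f := open_ball_on act E delta).
- exact: open_ball_on_open.
- by exists x => //; rewrite /open_ball_on/= dist_onxx.
have /choice[r rP] : forall y, exists u, u \in D /\ dist_on act E u y < delta.
  by move=> y; have [u] := DX y Logic.I; exists u.
(* Packings have bounded size: if two of their points are assigned the same ball of the finite
   cover, its centre lies in both closed balls. *)
have ok_card H : ok H -> (#|` H| <= #|` D|)%N.
  move=> [_ Hinj].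
  have <- : #|` [fset r y | y in H]%fset| = #|` H|.
    rewrite card_in_imfset//= => y z yH zH ryz; apply: Hinj => //.
    exists (r y); split; rewrite /closed_ball_on/= dist_on_sym ltW//; first exact: (rP _).2.
    by rewrite ryz; exact: (rP _).2.
  by apply/fsubset_leq_card/fsubsetP => _ /imfsetP[y /= _ ->]; exact: (rP _).1.
pose card_ok k := `[< exists H, ok H /\ #|` H| = k >].
have exk : exists k, card_ok k.
  by exists 0%N; apply/asboolP; exists fset0; split; [split|rewrite cardfs0].
have ubk k : card_ok k -> (k <= #|` D|)%N.
  by move=> /asboolP[H [okH <-]]; exact: ok_card.
have [k /asboolP[H [[HZ Hinj] Hk]] kmax] := ex_maxnP exk ubk.
(* A point farther than [2 * delta] from all centres could be added, against maximality. *)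
have Hcov z : Z z -> exists2 x, x \in H & dist_on act E x z <= 2 * delta.
  move=> Zz; apply: contrapT => far.
  have far' x : x \in H -> 2 * delta < dist_on act E x z.
    by move=> xH; rewrite ltNge; apply/negP => h; apply: far; exists x.
  have meet x y : (closed_ball_on act E delta x `&` closed_ball_on act E delta y) !=set0 ->
      dist_on act E x y <= 2 * delta.
    move=> [u []]; rewrite /closed_ball_on/= => xu yu.
    rewrite (le_trans (dist_on_triangle _ _ u _ _))// mulr_natl mulr2n lerD//.
    by rewrite dist_on_sym.
  have zH : z \notin H.
    by apply/negP => /far'; rewrite dist_onxx ltNge mulr_ge0// ltW.
  have : (#|` (z |` H)%fset| <= k)%N.
    apply: kmax; apply/asboolP; exists (z |` H)%fset; split=> //; split.
      by move=> x /= /fset1UP[->//|/HZ].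
    move=> x y /fset1UP[->|xH] /fset1UP[->|yH] //.
    - by move=> /meet; rewrite dist_on_sym leNgt far'.
    - by move=> /meet; rewrite leNgt far'.
    - exact: Hinj.
  by rewrite cardfsU1 zH Hk ltnn.
pose c i := nth x0 H i.
have cH i : (i < #|` H|)%N -> c i \in H by move=> iH; exact: mem_nth.
(* One family of constant index [n] bounds both sides: it covers at radius [3 * delta] and is
   disjoint at radius [delta]. *)
apply: (@le_trans _ _ (family_sum F lam [set i | (i < #|` H|)%N] (fun=> n))).
  apply: ereal_inf_lbound; exists [set i | (i < #|` H|)%N], c, (fun=> n).
  split=> //; split=> // z /Hcov[x xH xz]; exists (index x H) => /=.
    by rewrite index_mem.
  rewrite /open_ball_on/= /c nth_index// (le_lt_trans xz)// ltr_pM2r// ltr_nat //.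
apply: ereal_sup_ubound; exists [set i | (i < #|` H|)%N], c, (fun=> n).
split=> //; split=> // [i iH|i j iH jH ij]; first by apply: HZ; exact: cH.
apply/eqP; rewrite -(nth_uniq x0 iH jH (fset_uniq H)); apply/eqP.
by apply: Hinj => //; exact: cH.
Qed.

Lemma bowen_lim_le_packing lam delta Z : 0 < delta ->
  (bowen_lim act F lam (3 * delta)%R Z <= packing_lim act F lam delta Z)%E.
Proof.
move=> d0; apply: bowen_lim_le => e e0; apply: le_packing_lim => e' e'0.
have m0 : 0 < Num.min e e' by rewrite lt_min e0.
apply: le_trans (_ : _ <= bowen_pre act F lam (Num.min e e') (3 * delta)%R Z)%E _.
  by apply: bowen_pre_eps; rewrite m0 ge_min lexx.
apply: (le_trans (bowen_pre_le_packing _ _ d0 m0)).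
by apply: packing_pre_eps; rewrite m0 ge_min lexx orbT.
Qed.

(** Countable subadditivity of the Bowen measure carries the comparison from [packing_lim] to the
    infimum over countable covers. *)
Lemma htop_bowen_le_packing delta Z : 0 < delta ->
  (htop_bowen act F Z (3 * delta)%R <= htop_packing act F Z delta)%E.
Proof.
move=> d0; apply: ereal_inf_le_tmp => _ [l [l0 lZ] <-]; exists l => //; split=> //.
apply/eqP; rewrite eq_le bowen_lim_ge0 andbT -lZ.
apply: le_ereal_inf_tmp => _ [Zs ZZs <-].
apply: (le_trans (bowen_lim_bigcup _ _ _ _ ZZs)).
apply: lee_nneseries => [i _ _|i _]; first exact: bowen_lim_ge0.
exact: bowen_lim_le_packing.
Qed.

(** The balls are grouped by index. At most [expR (lam' * #|F n|)] of them have index [n], so they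
    contribute at most [1 / n - 1 / (n + 1)], and the sum over [n >= N] telescopes. *)
Lemma packing_family_le lam lam' delta eps (N : nat) I c m : 0 < delta -> (0 < N)%N ->
  (forall n, (N <= n)%N -> forall H : {fset X},
    delta_separated act (F n) delta H -> #|` H|%:R <= expR (lam' * #|` F n|%:R)) ->
  (forall n, (N <= n)%N ->
    expR (- (lam - lam') * #|` F n|%:R) <= n%:R^-1 - n.+1%:R^-1) ->
  (forall n, eps^-1 <= #|` F n|%:R -> (N <= n)%N) ->
  packing act F delta eps [set: X] I c m ->
  (family_sum F lam I m <= (N%:R^-1)%:E)%E.
Proof.
move=> d0 N0 sepN smallN epsN [_ sz tr]; pose a n := expR (- lam * #|` F n|%:R).
apply: ge_ereal_sup => _ [J [finJ JI] <-].
rewrite fsbig_finite//= sumEFin lee_fin; set D := fset_set J.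
have DI i : i \in D -> I i by rewrite /D in_fset_set// => /set_mem/JI.
pose B := (\max_(i <- D) m i).+1.
have mN i : i \in D -> (N <= m i < B)%N.
  move=> iD; apply/andP; split; first by apply/epsN/sz/DI.
  by rewrite ltnS; exact: leq_bigmax_seq.
apply: (@le_trans _ _ (\sum_(i <- D) \sum_(N <= n < B) (m i == n)%:R * a n)).
  rewrite big_seq [leRHS]big_seq; apply: ler_sum => i iD.
  rewrite (bigD1_seq (m i)) ?mem_index_iota ?mN ?iota_uniq//= eqxx mul1r lerDl.
  by apply: sumr_ge0 => n _; rewrite mulr_ge0 ?expR_ge0.
rewrite exchange_big/=.
apply: (@le_trans _ _ (\sum_(N <= n < B) (n%:R^-1 - n.+1%:R^-1))).
  rewrite big_nat_cond [leRHS]big_nat_cond; apply: ler_sum => n; rewrite andbT => /andP[Nn _].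
  rewrite -mulr_suml -natr_sum (sum_mem_fset D (fun i => m i == n)).
  set Dn := [fset i in D | _]%fset.
  have DnP i : i \in Dn -> I i /\ m i = n by rewrite !inE => /andP[/DI ? /eqP].
  (* Two centres of index [n] within [delta] would put one of them in both closed balls;
     disjointness thus makes the centres [delta]-separated. *)
  have cinj i j : i \in Dn -> j \in Dn -> dist_on act (F n) (c i) (c j) <= delta -> i = j.
    move=> /DnP[Ii mi] /DnP[Ij mj] cij; apply: tr => //; exists (c j).
    by split; rewrite /closed_ball_on/= ?mi ?mj ?dist_onxx// ltW.
  have cDn : #|` Dn|%:R <= expR (lam' * #|` F n|%:R).
    have <- : #|` [fset c i | i in Dn]%fset| = #|` Dn|.
      rewrite card_in_imfset//= => i j iD jD cij; apply: cinj => //.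
      by rewrite cij dist_onxx ltW.
    apply: sepN => // _ _ /imfsetP[i /= iD ->] /imfsetP[j /= jD ->] nij.
    rewrite ltNge; apply/negP => /(cinj _ _ iD jD) ij.
    by rewrite ij eqxx in nij.
  apply: le_trans (smallN _ Nn); apply: (@le_trans _ _ (expR (lam' * #|` F n|%:R) * a n)).
    by rewrite ler_wpM2r// expR_ge0.
  by rewrite /a -expRD -mulrDl ler_expR ler_wpM2r// opprB.
have [NB|BN] := leqP N B; last by rewrite big_geq ?invr_ge0// ltnW.
have := telescope_sumr (fun n => - (n%:R^-1 : R)) NB.
under eq_bigr do rewrite opprK addrC.
by move=> ->; rewrite opprK addrC gerDl oppr_le0 invr_ge0.
Qed.

Lemma htop_ge0 delta : (0 <= htop act F [set: X] delta)%E.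
Proof.
apply: limf_esup_ge0 => [|n]; first by case=> N _ /(_ N (leqnn N)).
rewrite mule_ge0 ?lee_fin ?invr_ge0// lne_ge0.
apply: le_trans (_ : (#|` [fset x0]%fset|%:R)%:E <= _)%E; first by rewrite cardfs1.
apply: card_le_sep_number => // x y; rewrite !in_fset1 => /eqP-> /eqP->.
by rewrite eqxx.
Qed.

Lemma htop_packing_le_htop delta : 0 < delta ->
  (htop_packing act F [set: X] delta <= htop act F [set: X] delta)%E.
Proof.
move=> d0; apply: lee_real_upper => r hr; apply/lee_addgt0Pr => e e0.
have r0 : 0 <= r by rewrite -lee_fin (le_trans (htop_ge0 delta)).
have e20 : 0 < e / 2 by rewrite divr_gt0.
rewrite -EFinD; apply: ereal_inf_lbound; exists (r + e); [split|by []]; first lra.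
have lim_le (t : R) : 0 < t -> (packing_lim act F (r + e) delta [set: X] <= t%:E)%E.
  move=> t0.
  have [N1 _ sep1] := htop_growth (folner_neq0 F_folner) hr e20.
  (* With this constant [expR (- (e / 2) * #|F n|)] is at most [(n + 1)^-2], hence at most
     [1 / n - 1 / (n + 1)]. *)
  have [N2 _ gr] := growth_ge (4 / e).
  have [N3 _ inv3] : \forall n \near \oo, (n.+1%:R^-1 : R) < t.
    exact: near_infty_natSinv_lt (PosNum t0).
  pose N := (maxn N1 (maxn N2 N3)).+1.
  have [eps eps0 epsN] := large_index N.
  apply: (le_trans (packing_lim_le_pre act F _ _ _ eps0)).
  apply: ge_ereal_sup => _ [I [c [m [pk ->]]]].
  apply: (@le_trans _ _ (N%:R^-1)%:E); last first.
    by rewrite lee_fin ltW// inv3//= !leq_max leqnn !orbT.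
  apply: (packing_family_le (lam := r + e) (lam' := r + e / 2) d0 _ _ _ epsN pk) => //.
    move=> n Nn H sH; apply: sep1 => //=.
    by rewrite (leq_trans _ (ltnW Nn))// leq_max leqnn.
  move=> n Nn; have n0 : (0 < n)%N by exact: leq_ltn_trans Nn.
  have n0R : 0 < n%:R :> R by rewrite ltr0n.
  have n1R : 0 < n.+1%:R :> R by rewrite ltr0n.
  have {gr} : 4 / e * ln n.+1%:R <= #|` F n|%:R.
    by apply: gr => /=; rewrite (leq_trans _ (ltnW Nn))// !leq_max leqnn orbT.
  rewrite mulrAC ler_pdivrMr// => gr.
  apply: (@le_trans _ _ (expR (- (2 * ln n.+1%:R)))); first by rewrite ler_expR; lra.
  rewrite expRN mulr_natl mulr2n expRD lnK ?posrE// -addn1 natrD in n1R *.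
  have -> : n%:R^-1 - (n%:R + 1)^-1 = (n%:R * (n%:R + 1))^-1 :> R.
    by field; rewrite !gt_eqF//; lra.
  rewrite lef_pV2 ?posrE ?mulr_gt0//; nra.
apply/eqP; rewrite eq_le (packing_measure_ge0 _ _ x0) andbT.
(* The cover by the constant sequence [X] has only terms of value [0], as [t] was arbitrary. *)
apply: le_trans (_ : _ <= \sum_(0 <= i <oo) packing_lim act F (r + e) delta [set: X])%E _.
  by apply: ereal_inf_lbound; exists (fun=> setT) => //; exists 0%N.
rewrite eseries0; first exact: lexx.
move=> i _ _; apply/eqP; rewrite eq_le (packing_lim_ge0 _ _ x0) andbT.
by apply/lee_addgt0Pr => t t0; rewrite add0e lim_le.
Qed.

Lemma mdim_eq_packing_bowen :
  mdim act F [set: X] = mdimP act F [set: X] /\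
  mdimP act F [set: X] = mdimB act F [set: X].
Proof.
have PH : (mdimP act F [set: X] <= mdim act F [set: X])%E.
  apply: (@mdim_of_scale _ _ _ _ _ 1) => // d d0; rewrite mul1r.
  exact: htop_packing_le_htop.
have HB : (mdim act F [set: X] <= mdimB act F [set: X])%E.
  by apply: (@mdim_of_scale _ _ _ _ _ 2) => [|d d0]; [lra|exact: htop_le_bowen].
have BP : (mdimB act F [set: X] <= mdimP act F [set: X])%E.
  by apply: (@mdim_of_scale _ _ _ _ _ 3) => [|d d0]; [lra|exact: htop_bowen_le_packing].
split; apply/eqP; rewrite eq_le.
  by rewrite PH (le_trans HB BP).
by rewrite BP (le_trans PH HB).
Qed.

End comparisons.

(** * Attained local values and equality of the three dimensions *)

Theorem theorem2p1 (R : realType) (G : groupType) (X : metricType R)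
    (act : G -> X -> X) (F : nat -> {fset G})
    (G_countable : countable [set: G]) (G_infinite : infinite_set [set: G])
    (G_amenable : amenable R G)
    (X_nonempty : [set: X] !=set0) (X_compact : compact [set: X])
    (act_action : continuous_action act)
    (F_folner : folner R F) (F_tempered : tempered R F)
    (F_growth : (#|` F n|%:R / ln (n.+1%:R : R)) @[n --> \oo] --> +oo) :
  [/\ is_max_of (local_mdim act F) (mdim act F [set: X]),
      is_max_of (local_mdimP act F) (mdimP act F [set: X]),
      is_max_of (local_mdimB act F) (mdimB act F [set: X]) &
      mdim act F [set: X] = mdimP act F [set: X] /\
      mdimP act F [set: X] = mdimB act F [set: X]].
Proof.
have [x0 _] := X_nonempty; have [_ actM act_cont] := act_action.
have Foo := card_folner_infty F_growth; have F0 := folner_neq0 F_folner.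
split; last exact: mdim_eq_packing_bowen.
- apply: (local_of_max X_compact X_nonempty) => A B.
    by move=> AB; apply: mdim_of_mono => d _; exact: htop_mono.
  by apply: mdim_ofU => d _; exact: htopU.
- apply: (local_of_max X_compact X_nonempty) => A B.
    by move=> AB; apply: mdim_of_mono => d _; exact: htop_packing_mono.
  by apply: mdim_ofU => d _; exact: htop_packingU.
- apply: (local_of_max X_compact X_nonempty) => A B.
    by move=> AB; apply: mdim_of_mono => d _; exact: htop_bowen_mono.
  by apply: mdim_ofU => d _; exact: htop_bowenU.
Qed.
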